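(* Let $\mathbf C$ be a Markov category that has causal traces, let $\Sigma$ be a monoidal signature, let $f:m\otimes w\to n\otimes w$ be a morphism in $\mathbf{FreeMarkov}_\Sigma$, and let $[\![-]\!]:\mathbf{FreeMarkov}_\Sigma\to\mathbf C$ be an interpreting functor. If $f$ is non-signalling (from $w$ to $w$), then so is $[\![f]\!]$, and $$[\![\mathbf{contr}^w(f)]\!]=\mathbf{tr}^{[\![w]\!]}\big([\![f]\!]\big).$$
   Context: A Markov category is a symmetric monoidal category $(\mathbf C,\otimes,I)$ in which every object $X$ carries a commutative comonoid $\Delta_X:X\to X\otimes X$, $\mathrm{del}_X:X\to I$, compatible with $\otimes$, and every $f:X\to Y$ satisfies $\mathrm{del}_Y\circ f=\mathrm{del}_X$. Coherence isomorphisms are suppressed. A morphism $f:X\otimes W'\to Y\otimes W$ is non-signalling (from $W'$ to $W$) if there is $f_s:X\to W$ with $(\mathrm{del}_Y\otimes\mathrm{id}_W)\circ f=f_s\otimes\mathrm{del}_{W'}$; a non-signalling $f:X\otimes W\to Y\otimes W$ is called traceable (with respect to $W$). $\mathbf C$ has causal traces if it is equipped with an operation $\mathbf{tr}^W$ sending traceable morphisms $X\otimes W\to Y\otimes W$ to morphisms $X\to Y$ such that: (tightening) if $f:X\otimes W\to Y\otimes W$ is traceable, $g:X'\to X$, $h:Y\to Y'$, then $(h\otimes\mathrm{id}_W)\circ f\circ(g\otimes\mathrm{id}_W)$ is traceable with trace $h\circ\mathbf{tr}^W(f)\circ g$; (sliding) if $f:X\otimes W'\to Y\otimes W$ is non-signalling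 and $g:W\to W'$, then $(\mathrm{id}_Y\otimes g)\circ f$ and $f\circ(\mathrm{id}_X\otimes g)$ are traceable and $\mathbf{tr}^{W'}((\mathrm{id}_Y\otimes g)\circ f)=\mathbf{tr}^W(f\circ(\mathrm{id}_X\otimes g))$; (vanishing) every $g:X\otimes I\to Y\otimes I$ is traceable with $\mathbf{tr}^I(g)=g$; (associativity) if $f:X\otimes U\otimes V\to Y\otimes U\otimes V$ is traceable with respect to $U\otimes V$, then it is traceable with respect to $V$, $\mathbf{tr}^V(f)$ is traceable with respect to $U$, and $\mathbf{tr}^{U\otimes V}(f)=\mathbf{tr}^U(\mathbf{tr}^V(f))$; (superposition) if $f$ is traceable and $g:X'\to Y'$, then $g\otimes f$ is traceable with $\mathbf{tr}^W(g\otimes f)=g\otimes\mathbf{tr}^W(f)$; (yanking) $\mathrm{swap}_{W,W}$ is traceable with $\mathbf{tr}^W(\mathrm{swap}_{W,W})=\mathrm{id}_W$. Free Markov categories. A hypergraph $G$ has a set $W(G)$ of wires and sets $B_{m,n}(G)$ ($m,n\in\mathbb N$) of boxes, each box $b\in B_{m,n}(G)$ having a list of $m$ input wires and a list of $n$ output wires; homomorphisms are maps of wires and boxes preserving arities and input/output lists. It is finite if it has finitely many wires and boxes, and discrete if it has no boxes; $\underline m$ denotes the discrete hypergraph with $m$ wires. Let $\mathrm{in}(b,w)$ and $\mathrm{out}(b,w)$ be the number of times $w$ occurs among the inputs, resp. outputs, of $b$. A monoidal signature $\Sigma$ (types and typed generators) is regarded as a hypergraph with types as wires and generators as boxes. A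 Markov string diagram over $\Sigma$ is an isomorphism class of cospans $\underline m\xrightarrow{p}G\xleftarrow{q}\underline n$ of finite hypergraphs over $\Sigma$ (i.e. with compatible homomorphisms to $\Sigma$) such that: $G$ is acyclic (there is no sequence $w_1,b_1,\dots,w_k,b_k,w_{k+1}=w_1$, $k\ge1$, with $\mathrm{in}(b_i,w_i)>0$ and $\mathrm{out}(b_i,w_{i+1})>0$); left monogamy holds, i.e. $|p^{-1}(w)|+\sum_b\mathrm{out}(b,w)=1$ for each wire $w$; and there is no eliminable box, where $b$ is eliminable if every wire $w$ with $\mathrm{out}(b,w)>0$ satisfies $q^{-1}(w)=\emptyset$ and $\mathrm{in}(b',w)=0$ for all boxes $b'$. Normalization means repeatedly deleting eliminable boxes together with their output wires. $\mathbf{FreeMarkov}_\Sigma$ has as objects homomorphisms $\underline m\to\Sigma$ (lists of types; written $m$), as morphisms $m\to n$ the Markov string diagrams, composed by pushout followed by normalization; $\otimes$ is coproduct; copy and delete on a single wire are the cospans $\underline1\to\underline1\leftarrow\underline2$ and $\underline1\to\underline1\leftarrow\underline0$. It is the free Markov category over $\Sigma$. An interpreting functor is a Markov functor $\mathbf{FreeMarkov}_\Sigma\to\mathbf C$ (strong symmetric monoidal, preserving copy and delete). Contraction. For a non-signalling $f:m\otimes w\to n\otimes w$ in $\mathbf{FreeMarkov}_\Sigma$ given by $\underline m+\underline w\xrightarrow{[i,i']}G\xleftarrow{[j,j']}\underline n+\underline w$, let $G'$ be the pushout of $[i',j']:\underline w+\underline w\to G$ along $[\mathrm{id},\mathrm{id}]:\underline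 w+\underline w\to\underline w$; $\mathbf{contr}^w(f):m\to n$ is the normalization of the cospan $\underline m\to G\to G'\leftarrow G\leftarrow\underline n$ obtained from $i$ and $j$. *)

(* Defs.v *)
From mathcomp Require Import all_boot.
From mathcomp Require Import boolp.

Set Implicit Arguments.
Unset Strict Implicit.
Unset Printing Implicit Defensive.

(* The operations of a symmetric monoidal category with copy and delete maps,
   without their laws.  The coherence isomorphisms are explicit. *)
Record markov_data := MarkovData {
  ob : Type;
  hom : ob -> ob -> Type;
  idm : forall x, hom x x;
  comp : forall x y z, hom y z -> hom x y -> hom x z;
  unit_ob : ob;
  tens_ob : ob -> ob -> ob;
  tens : forall x y x' y',
    hom x y -> hom x' y' -> hom (tens_ob x x') (tens_ob y y');
  assoc : forall x y z,
    hom (tens_ob (tens_ob x y) z) (tens_ob x (tens_ob y z));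
  assoc_inv : forall x y z,
    hom (tens_ob x (tens_ob y z)) (tens_ob (tens_ob x y) z);
  lunit : forall x, hom (tens_ob unit_ob x) x;
  lunit_inv : forall x, hom x (tens_ob unit_ob x);
  runit : forall x, hom (tens_ob x unit_ob) x;
  runit_inv : forall x, hom x (tens_ob x unit_ob);
  swap : forall x y, hom (tens_ob x y) (tens_ob y x);
  copy : forall x, hom x (tens_ob x x);
  del : forall x, hom x unit_ob
}.

Arguments idm {m} x.
Arguments comp {m x y z} g f.
Arguments unit_ob {m}.
Arguments tens_ob {m} x y.
Arguments tens {m x y x' y'} f g.
Arguments assoc {m} x y z.
Arguments assoc_inv {m} x y z.
Arguments lunit {m} x.
Arguments lunit_inv {m} x.
Arguments runit {m} x.
Arguments runit_inv {m} x.
Arguments swap {m} x y.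
Arguments copy {m} x.
Arguments del {m} x.

Declare Scope cat_scope.
Delimit Scope cat_scope with cat.
Notation "g '\;o' f" := (comp g f)
  (at level 50, left associativity) : cat_scope.
Notation "x '\ox' y" := (tens_ob x y)
  (at level 40, left associativity) : cat_scope.
Notation "f '\tx' g" := (tens f g)
  (at level 40, left associativity) : cat_scope.
Local Open Scope cat_scope.

(* (X (x) X) (x) (Y (x) Y) -> (X (x) Y) (x) (X (x) Y), exchanging the two inner
   factors. *)
Definition mid_swap (C : markov_data) (x y : ob C) :
    hom (x \ox x \ox (y \ox y)) (x \ox y \ox (x \ox y)) :=
  assoc_inv x y (x \ox y)
  \;o (idm x \tx (assoc y x y \;o (swap x y \tx idm y) \;o assoc_inv x y y))
  \;o assoc x x (y \ox y).

Record markov_laws (C : markov_data) : Prop := MarkovLaws {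
  comp_id_l : forall (x y : ob C) (f : hom x y), idm y \;o f = f;
  comp_id_r : forall (x y : ob C) (f : hom x y), f \;o idm x = f;
  comp_assoc : forall (x y z t : ob C) (h : hom z t) (g : hom y z) (f : hom x y),
    h \;o (g \;o f) = h \;o g \;o f;
  tens_id : forall x y : ob C, idm x \tx idm y = idm (x \ox y);
  tens_comp : forall (x y z x' y' z' : ob C)
      (g : hom y z) (f : hom x y) (g' : hom y' z') (f' : hom x' y'),
    (g \;o f) \tx (g' \;o f') = (g \tx g') \;o (f \tx f');
  assocK : forall x y z : ob C, assoc_inv x y z \;o assoc x y z = idm _;
  assoc_invK : forall x y z : ob C, assoc x y z \;o assoc_inv x y z = idm _;
  lunitK : forall x : ob C, lunit_inv x \;o lunit x = idm _;
  lunit_invK : forall x : ob C, lunit x \;o lunit_inv x = idm _;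
  runitK : forall x : ob C, runit_inv x \;o runit x = idm _;
  runit_invK : forall x : ob C, runit x \;o runit_inv x = idm _;
  assoc_nat : forall (x y z x' y' z' : ob C)
      (f : hom x x') (g : hom y y') (h : hom z z'),
    assoc x' y' z' \;o (f \tx g \tx h) = (f \tx (g \tx h)) \;o assoc x y z;
  lunit_nat : forall (x y : ob C) (f : hom x y),
    lunit y \;o (idm unit_ob \tx f) = f \;o lunit x;
  runit_nat : forall (x y : ob C) (f : hom x y),
    runit y \;o (f \tx idm unit_ob) = f \;o runit x;
  pentagon : forall x y z t : ob C,
    assoc x y (z \ox t) \;o assoc (x \ox y) z t =
    (idm x \tx assoc y z t) \;o assoc x (y \ox z) t \;o (assoc x y z \tx idm t);
  triangle : forall x y : ob C,
    (idm x \tx lunit y) \;o assoc x unit_ob y = runit x \tx idm y;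
  swap_nat : forall (x y x' y' : ob C) (f : hom x x') (g : hom y y'),
    swap x' y' \;o (f \tx g) = (g \tx f) \;o swap x y;
  swapK : forall x y : ob C, swap y x \;o swap x y = idm (x \ox y);
  hexagon : forall x y z : ob C,
    assoc y z x \;o swap x (y \ox z) \;o assoc x y z =
    (idm y \tx swap x z) \;o assoc y x z \;o (swap x y \tx idm z);
  copy_assoc : forall x : ob C,
    assoc x x x \;o (copy x \tx idm x) \;o copy x = (idm x \tx copy x) \;o copy x;
  copy_del_l : forall x : ob C, lunit x \;o (del x \tx idm x) \;o copy x = idm x;
  copy_del_r : forall x : ob C, runit x \;o (idm x \tx del x) \;o copy x = idm x;
  copy_comm : forall x : ob C, swap x x \;o copy x = copy x;
  copy_tens : forall x y : ob C,
    copy (x \ox y) = mid_swap x y \;o (copy x \tx copy y);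
  del_tens : forall x y : ob C,
    del (x \ox y) = lunit unit_ob \;o (del x \tx del y);
  copy_unit : copy (@unit_ob C) = lunit_inv unit_ob;
  del_unit : del (@unit_ob C) = idm unit_ob;
  del_nat : forall (x y : ob C) (f : hom x y), del y \;o f = del x
}.

Record markov_category := MarkovCategory {
  markov_cat_data :> markov_data;
  markov_cat_laws : markov_laws markov_cat_data
}.

Record markov_functor (C D : markov_data) := MarkovFunctor {
  fob :> ob C -> ob D;
  fhom : forall x y, hom x y -> hom (fob x) (fob y);
  fmu : forall x y, hom (fob x \ox fob y) (fob (x \ox y));
  fmu_inv : forall x y, hom (fob (x \ox y)) (fob x \ox fob y);
  feps : hom unit_ob (fob unit_ob);
  feps_inv : hom (fob unit_ob) unit_ob;
  fhom_id : forall x, fhom (idm x) = idm (fob x);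
  fhom_comp : forall x y z (g : hom y z) (f : hom x y),
    fhom (g \;o f) = fhom g \;o fhom f;
  fmuK : forall x y, fmu_inv x y \;o fmu x y = idm _;
  fmu_invK : forall x y, fmu x y \;o fmu_inv x y = idm _;
  fepsK : feps_inv \;o feps = idm _;
  feps_invK : feps \;o feps_inv = idm _;
  fmu_nat : forall x y x' y' (f : hom x x') (g : hom y y'),
    fhom (f \tx g) \;o fmu x y = fmu x' y' \;o (fhom f \tx fhom g);
  fmu_assoc : forall x y z,
    fhom (assoc x y z) \;o fmu (x \ox y) z \;o (fmu x y \tx idm (fob z)) =
    fmu x (y \ox z) \;o (idm (fob x) \tx fmu y z)
      \;o assoc (fob x) (fob y) (fob z);
  fmu_lunit : forall x,
    fhom (lunit x) \;o fmu unit_ob x \;o (feps \tx idm (fob x)) = lunit (fob x);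
  fmu_runit : forall x,
    fhom (runit x) \;o fmu x unit_ob \;o (idm (fob x) \tx feps) = runit (fob x);
  fmu_swap : forall x y,
    fhom (swap x y) \;o fmu x y = fmu y x \;o swap (fob x) (fob y);
  fhom_copy : forall x, fhom (copy x) = fmu x x \;o copy (fob x);
  fhom_del : forall x, fhom (del x) = feps \;o del (fob x)
}.

(* F f conjugated by the structure isomorphisms of F. *)
Definition fhom_tens (C D : markov_data) (F : markov_functor C D) (x y x' y' : ob C)
    (f : hom (x \ox y) (x' \ox y')) : hom (F x \ox F y) (F x' \ox F y') :=
  fmu_inv F x' y' \;o fhom F f \;o fmu F x y.

Definition nonsignalling (C : markov_data) (x w' y w : ob C)
    (f : hom (x \ox w') (y \ox w)) : Prop :=
  exists fs : hom x w,
    lunit w \;o (del y \tx idm w) \;o f = runit w \;o (fs \tx del w').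

Definition traceable (C : markov_data) (x y w : ob C)
  (f : hom (x \ox w) (y \ox w)) : Prop := nonsignalling f.

(* Each axiom asserts the traceability of the morphisms involved together with
   the equation between their traces. *)
Record causal_traces (C : markov_data) := CausalTraces {
  tr : forall (w x y : ob C) (f : hom (x \ox w) (y \ox w)),
    traceable f -> hom x y;
  tightening : forall (w x y x' y' : ob C) (f : hom (x \ox w) (y \ox w))
      (g : hom x' x) (h : hom y y') (tf : traceable f),
    exists t : traceable ((h \tx idm w) \;o f \;o (g \tx idm w)),
      tr t = h \;o tr tf \;o g;
  sliding : forall (w w' x y : ob C) (f : hom (x \ox w') (y \ox w))
      (g : hom w w'), nonsignalling f ->
    exists (t' : traceable ((idm y \tx g) \;o f))
           (t : traceable (f \;o (idm x \tx g))), tr t' = tr t;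
  vanishing : forall (x y : ob C) (g : hom (x \ox unit_ob) (y \ox unit_ob)),
    exists t : traceable g, tr t = runit y \;o g \;o runit_inv x;
  associativity : forall (u v x y : ob C)
      (f : hom (x \ox (u \ox v)) (y \ox (u \ox v))) (tf : traceable f),
    exists (tv : traceable (assoc_inv y u v \;o f \;o assoc x u v))
           (tu : traceable (tr tv)), tr tf = tr tu;
  superposition : forall (w x y x' y' : ob C) (f : hom (x \ox w) (y \ox w))
      (g : hom x' y') (tf : traceable f),
    exists t : traceable (assoc_inv y' y w \;o (g \tx f) \;o assoc x' x w),
      tr t = g \tx tr tf;
  yanking : forall w : ob C,
    exists t : traceable (swap w w), tr t = idm w
}.

(* The disjoint union over (m, n) of the sets of boxes of arity (m, n); the
   arity of a box is given by the lengths of its two lists of wires. *)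
Record hypergraph := Hypergraph {
  wire : Type;
  box : Type;
  box_in : box -> seq wire;
  box_out : box -> seq wire
}.

(* A monoidal signature, its wires being the types and its boxes the
   generators. *)
Definition signature := hypergraph.

(* Finite hypergraphs over S; [wlab] and [blab] are the two components of the
   homomorphism to S. *)
Record graph (S : signature) := Graph {
  gwire : finType;
  gbox : finType;
  gin : gbox -> seq gwire;
  gout : gbox -> seq gwire;
  wlab : gwire -> wire S;
  blab : gbox -> box S;
  gin_lab : forall b, map wlab (gin b) = box_in (blab b);
  gout_lab : forall b, map wlab (gout b) = box_out (blab b)
}.

Arguments gin {S g} b.
Arguments gout {S g} b.
Arguments wlab {S g} w.
Arguments blab {S g} b.

Section Graphs.
Variable S : signature.
Implicit Types G H K : graph S.

Definition succ G : rel (gwire G) :=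
  fun w w' => [exists b : gbox G, (w \in gin b) && (w' \in gout b)].
Arguments succ : clear implicits.

Definition acyclic G : Prop :=
  forall (w : gwire G) (s : seq (gwire G)),
    path (succ G) w s -> last w s = w -> s = [::].

Lemma acyclic_rank G : acyclic G -> exists r : gwire G -> nat,
  (forall w w', succ G w w' -> r w < r w') /\ (forall w, r w <= #|gwire G|).
Proof.
move=> acy; exists (fun w => #|[pred x | connect (succ G) x w]|).
split=> [w w' ww'|w]; last exact: max_card.
apply/proper_card/properP; split.
  by apply/subsetP => x; rewrite !inE => xw; apply/(connect_trans xw)/connect1.
exists w'; rewrite !inE ?connect0 //; apply/negP => /connectP[s ps eq_w].
by have := acy w (w' :: s); rewrite /= ww' ps => /(_ isT (esym eq_w)).
Qed.

Lemma acyclicP G :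
  acyclic G <-> exists r : gwire G -> nat, forall w w', succ G w w' -> r w < r w'.
Proof.
split=> [/acyclic_rank[r [r_lt _]] | [r r_lt] w s]; first by exists r.
have r_path x t : path (succ G) x t -> r x + size t <= r (last x t).
  elim: t x => [|y t IHt] x /=; first by rewrite addn0.
  case/andP=> /r_lt xy /IHt; apply: leq_trans; rewrite addnS -addSn.
  by rewrite leq_add2r.
by move/r_path=> + eq_w; rewrite eq_w -{2}[r w]addn0 leq_add2l leqn0 => /nilP.
Qed.

(* The discrete hypergraph on the list of types m, wire i being labelled by the
   i-th entry of m. *)
Definition discrete (m : seq (wire S)) : graph S :=
  @Graph S 'I_(size m) void (of_void _) (of_void _)
    (tnth (in_tuple m)) (of_void _)
    (fun b => match b with end) (fun b => match b with end).

Section Sum.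
Variables G H : graph S.

Definition sum_in (b : gbox G + gbox H) : seq (gwire G + gwire H) :=
  match b with inl b => map inl (gin b) | inr b => map inr (gin b) end.
Definition sum_out (b : gbox G + gbox H) : seq (gwire G + gwire H) :=
  match b with inl b => map inl (gout b) | inr b => map inr (gout b) end.
Definition sum_wlab (w : gwire G + gwire H) : wire S :=
  match w with inl w => wlab w | inr w => wlab w end.
Definition sum_blab (b : gbox G + gbox H) : box S :=
  match b with inl b => blab b | inr b => blab b end.

Lemma sum_in_lab b : map sum_wlab (sum_in b) = box_in (sum_blab b).
Proof. by case: b => b /=; rewrite -map_comp gin_lab. Qed.

Lemma sum_out_lab b : map sum_wlab (sum_out b) = box_out (sum_blab b).
Proof. by case: b => b /=; rewrite -map_comp gout_lab. Qed.

Definition gsum : graph S := Graph sum_in_lab sum_out_lab.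

End Sum.

(* The quotient of a hypergraph by the equivalence relation on wires generated
   by a list of pairs, its wires being the canonical representatives. *)
Section Quotient.
Variables (K : graph S) (z : seq (gwire K * gwire K)).
Hypothesis z_lab : forall x y, (x, y) \in z -> wlab x = wlab y.

Definition glue : rel (gwire K) :=
  fun x y => ((x, y) \in z) || ((y, x) \in z).

Lemma glue_sym : connect_sym glue.
Proof. by apply: sym_connect_sym => x y; rewrite /glue orbC. Qed.

Definition quot_wire : Type := {x : gwire K | roots glue x}.

Definition cls (x : gwire K) : quot_wire :=
  exist (fun x => is_true (roots glue x)) (root glue x) (roots_root glue_sym x).

Lemma glue_lab x y : connect glue x y -> wlab x = wlab y.
Proof.
case/connectP=> s; elim: s x => [|t s IHs] x /=; first by move=> _ ->.
by case/andP=> /orP[] /z_lab xt /IHs{}IHs /IHs <-.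
Qed.

Lemma cls_lab x : wlab (val (cls x)) = wlab x.
Proof. exact/esym/glue_lab/connect_root. Qed.

Lemma clsP x y : reflect (cls x = cls y) (connect glue x y).
Proof.
apply: (iffP idP) => [/(rootP glue_sym) xy | [xy]]; last exact/(rootP glue_sym).
exact: val_inj.
Qed.

Lemma map_cls_lab s :
  map (fun w : quot_wire => wlab (val w)) (map cls s) = map wlab s.
Proof. by rewrite -map_comp; apply: eq_map => x; apply: cls_lab. Qed.

Definition gquot : graph S :=
  @Graph S quot_wire (gbox K)
    (fun b => map cls (gin b)) (fun b => map cls (gout b))
    (fun w => wlab (val w)) blab
    (fun b => etrans (map_cls_lab (gin b)) (gin_lab b))
    (fun b => etrans (map_cls_lab (gout b)) (gout_lab b)).

End Quotient.

Section Pushout.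
Variables (G H : graph S) (u : seq (gwire G)) (v : seq (gwire H)).
Hypothesis uv_lab : map wlab u = map wlab v.

Definition push_pairs : seq (gwire (gsum G H) * gwire (gsum G H)) :=
  zip (map inl u) (map inr v).

Lemma push_pairsP x y : (x, y) \in push_pairs <->
  exists i a b, [/\ onth u i = Some a, onth v i = Some b, x = inl a & y = inr b].
Proof.
rewrite /push_pairs; elim: u v => [|a s IHs] [|b t] /=.
- by split=> [|[i [? [? []]]]] //; rewrite onth0n.
- by split=> [|[i [? [? []]]]] //; rewrite onth0n.
- by split=> [|[i [? [? [_]]]]] //; rewrite onth0n.
rewrite inE; split=> [/orP[/eqP[-> ->] | /IHs[i [c [d [? ? ? ?]]]]] | ].
- by exists 0, a, b.
- by exists i.+1, c, d.
case=> [[|i]] [c [d []]] /=; first by case=> -> [->] -> ->; rewrite eqxx.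
by move=> ? ? ? ?; apply/orP; right; apply/IHs; exists i, c, d.
Qed.

Lemma push_pairs_lab x y : (x, y) \in push_pairs -> wlab x = wlab y.
Proof.
case/push_pairsP=> i [a [b [ua vb -> ->]]] /=.
have := congr1 (fun s => onth s i) uv_lab; rewrite /= !onth_map ua vb /=.
by case.
Qed.

(* The pushout of G and H along the discrete hypergraph with interface maps the
   lists u and v. *)
Definition pushout : graph S := gquot push_pairs_lab.
Definition push_inl (x : gwire G) : gwire pushout := cls push_pairs (inl x).
Definition push_inr (y : gwire H) : gwire pushout := cls push_pairs (inr y).

Lemma push_inl_lab s : map wlab (map push_inl s) = map wlab s.
Proof. by rewrite -map_comp; apply: eq_map => x; apply: (cls_lab push_pairs_lab). Qed.

Lemma push_inr_lab s : map wlab (map push_inr s) = map wlab s.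
Proof. by rewrite -map_comp; apply: eq_map => x; apply: (cls_lab push_pairs_lab). Qed.

End Pushout.

Definition indeg G (p : seq (gwire G)) (w : gwire G) : nat :=
  count_mem w p + \sum_(b : gbox G) count_mem w (gout b).

Lemma succ_sum_ll G H x y :
  succ (gsum G H) (inl x) (inl y) = succ G x y.
Proof.
apply/existsP/existsP => [[[b|b]] /= /andP[xb yb] | [b /andP[xb yb]]].
- by exists b; move: xb yb; rewrite !(mem_map (@inl_inj _ (gwire H))) => -> ->.
- by case/mapP: xb.
- by exists (inl b) => /=; rewrite !(mem_map (@inl_inj _ (gwire H))) xb.
Qed.

Lemma succ_sum_rr G H x y :
  succ (gsum G H) (inr x) (inr y) = succ H x y.
Proof.
apply/existsP/existsP => [[[b|b]] /= /andP[xb yb] | [b /andP[xb yb]]].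
- by case/mapP: xb.
- by exists b; move: xb yb; rewrite !(mem_map (@inr_inj (gwire G) _)) => -> ->.
- by exists (inr b) => /=; rewrite !(mem_map (@inr_inj (gwire G) _)) xb.
Qed.

Lemma succ_sum_lr G H x y : succ (gsum G H) (inl x) (inr y) = false.
Proof. by apply/existsP => -[[b|b]] /= /andP[] /mapP[? _ ?] /mapP[? _ ?]. Qed.

Lemma succ_sum_rl G H x y : succ (gsum G H) (inr x) (inl y) = false.
Proof. by apply/existsP => -[[b|b]] /= /andP[] /mapP[? _ ?] /mapP[? _ ?]. Qed.

Lemma indeg_suml G H p1 p2 x :
  @indeg (gsum G H) (map inl p1 ++ map inr p2) (inl x) = indeg p1 x.
Proof.
have cl s : count_mem (inl x : gwire G + gwire H) (map inl s) = count_mem x s.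
  by rewrite count_map; apply: eq_count => y /=; apply/eqP/eqP => [[]|->].
have cr s : count_mem (inl x : gwire G + gwire H) (map inr s) = 0.
  by rewrite count_map; apply/eqP; rewrite -leqn0 leqNgt -has_count; apply/hasP => -[].
rewrite /indeg count_cat cl cr addn0 big_sumType /=.
rewrite [X in _ + (_ + X)]big1 ?addn0; last by move=> b _; apply: cr.
by congr (_ + _); apply: eq_bigr => b _; apply: cl.
Qed.

Lemma indeg_sumr G H p1 p2 y :
  @indeg (gsum G H) (map inl p1 ++ map inr p2) (inr y) = indeg p2 y.
Proof.
have cl s : count_mem (inr y : gwire G + gwire H) (map inr s) = count_mem y s.
  by rewrite count_map; apply: eq_count => x /=; apply/eqP/eqP => [[]|->].
have cr s : count_mem (inr y : gwire G + gwire H) (map inl s) = 0.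
  by rewrite count_map; apply/eqP; rewrite -leqn0 leqNgt -has_count; apply/hasP => -[].
rewrite /indeg count_cat cl cr big_sumType /=.
rewrite [X in _ + (X + _)]big1 ?add0n; last by move=> b _; apply: cr.
by congr (_ + _); apply: eq_bigr => b _; apply: cl.
Qed.

(* A choice rho of representatives controls the quotient. *)
Section QuotientTheory.
Variables (K : graph S) (z : seq (gwire K * gwire K)).
Hypothesis z_lab : forall x y, (x, y) \in z -> wlab x = wlab y.
Variable rho : gwire K -> gwire K.
Hypothesis rho_glue : forall x y, (x, y) \in z -> rho x = rho y.
Hypothesis glue_rho : forall x, connect (glue z) x (rho x).

Lemma rhoP x y : reflect (rho x = rho y) (connect (glue z) x y).
Proof.
apply: (iffP idP) => [/connectP[s] | xy].
  elim: s x => [|t s IHs] x /=; first by move=> _ ->.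
  by case/andP=> /orP[] /rho_glue xt /IHs{}IHs /IHs <-.
by apply: connect_trans (glue_rho x) _; rewrite xy glue_sym.
Qed.

Lemma cls_rho x y : cls z x = cls z y <-> rho x = rho y.
Proof. by split=> [/clsP/rhoP | /rhoP/clsP]. Qed.

Lemma rho_idem x : rho (rho x) = rho x.
Proof. by apply/esym/rhoP. Qed.

Lemma quot_ex (c : gwire (gquot z_lab)) : exists x, c = cls z x.
Proof.
by exists (val c); apply: val_inj => /=; case: c => x /= /eqP.
Qed.

Lemma gquot_acyclic (r : gwire K -> nat) :
  (forall w w', succ K w w' -> r (rho w) < r (rho w')) -> acyclic (gquot z_lab).
Proof.
move=> r_lt; apply/acyclicP; exists (fun c => r (rho (val c))) => c c'.
case/existsP=> b /andP[/mapP[w wb ->] /mapP[w' wb' ->]].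
have rho_val x : rho (val (cls z x)) = rho x by apply/esym/rhoP/connect_root.
by rewrite !rho_val; apply: r_lt; apply/existsP; exists b; rewrite wb.
Qed.

Lemma gquot_indeg (p : seq (gwire K)) :
    (forall x, indeg p x = (rho x == x)) ->
  forall c, @indeg (gquot z_lab) (map (cls z) p) c = 1.
Proof.
move=> p_rho c; have [x0 {c}->] := quot_ex c.
have cnt s : count_mem (cls z x0) (map (cls z) s)
    = \sum_(x | cls z x == cls z x0) count_mem x s.
  elim: s => [|a s IHs] /=; first by rewrite big1.
  rewrite IHs big_split /=; congr (_ + _).
  under eq_bigr => x _ do rewrite -[nat_of_bool _]/(if a == x then 1 else 0).
  rewrite -big_mkcondr /= sum1_count; have [ax|nax] := eqVneq (cls z a) (cls z x0).
    rewrite (@eq_count _ _ (pred1 a)) ?count_uniq_mem ?index_enum_uniq ?mem_index_enum //.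
    by move=> y /=; rewrite [a == y]eq_sym andb_idl // => /eqP->; rewrite ax.
  rewrite (@eq_count _ _ pred0) ?count_pred0 // => y /=.
  by apply/negP => /andP[/eqP yx /eqP ay]; move: nax; rewrite ay yx eqxx.
have -> : @indeg (gquot z_lab) (map (cls z) p) (cls z x0)
    = \sum_(x | cls z x == cls z x0) indeg p x.
  rewrite /indeg cnt big_split /=; congr (_ + _).
  by rewrite exchange_big /=; apply: eq_bigr => b _; apply: cnt.
rewrite (bigD1 (rho x0)) /=; last by apply/eqP/cls_rho/rho_idem.
rewrite p_rho rho_idem eqxx big1 // => x /andP[/eqP/cls_rho xx0 nx].
by rewrite p_rho xx0 eq_sym (negbTE nx).
Qed.

End QuotientTheory.

(* Cospans over S from the discrete hypergraph on m to that on n; the two legs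
   are the homomorphisms sending wire i to the i-th entry of a list. *)
Record cospan (m n : seq (wire S)) := Cospan {
  apex : graph S;
  lleg : seq (gwire apex);
  rleg : seq (gwire apex);
  lleg_lab : map wlab lleg = m;
  rleg_lab : map wlab rleg = n
}.

Definition left_monogamous m n (c : cospan m n) : Prop :=
  forall w : gwire (apex c),
    count_mem w (lleg c) + \sum_(b : gbox (apex c)) count_mem w (gout b) = 1.

Definition premarkov m n (c : cospan m n) : Prop :=
  acyclic (apex c) /\ left_monogamous c.

Section Pre.
Variables (m n : seq (wire S)) (c : cospan m n).
Hypothesis pre_c : premarkov c.

Lemma lleg_uniq : uniq (lleg c).
Proof.
apply: count_mem_uniq => x; rewrite -has_pred1 has_count.
have : count_mem x (lleg c) <= 1 by rewrite -(pre_c.2 x) leq_addr.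
by case: count => [|[]].
Qed.

Lemma lleg_gout w b : w \in lleg c -> w \in gout b -> False.
Proof.
rewrite -!has_pred1 !has_count => wl wb; have := pre_c.2 w.
rewrite (bigD1 b) //= => eq1; have : 1 < 1; last by [].
by rewrite -{2}eq1 -addn1 leq_add // addn_gt0 wb.
Qed.

Lemma succ_lleg x y : succ _ x y -> y \in lleg c -> False.
Proof. by case/existsP=> b /andP[_ yb] yl; apply: lleg_gout yb. Qed.

Lemma connect_lleg x y : connect (succ (apex c)) x y -> y \in lleg c -> x = y.
Proof.
case/connectP=> s; case/lastP: s => [|s t]; first by [].
rewrite rcons_path last_rcons => /andP[_ st] -> /(succ_lleg st) [].
Qed.

Lemma index_lleg i x : onth (lleg c) i = Some x -> index x (lleg c) = i.
Proof.
move=> ix; have i_lt: i < size (lleg c) by rewrite -onthTE ix.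
by rewrite -{1}(onth_nth x _ _ _ ix) index_uniq ?lleg_uniq.
Qed.

End Pre.

Section Normalization.
Variables (m n : seq (wire S)) (c : cospan m n).

(* b is eliminable in the cospan obtained from c by deleting the boxes in D
   together with their output wires. *)
Definition elim_after (D : {set gbox (apex c)}) (b : gbox (apex c)) : bool :=
  all (fun w => (w \notin rleg c) &&
                [forall b', (b' \notin D) ==> (w \notin gin b')]) (gout b).

Definition eliminable : pred (gbox (apex c)) := elim_after set0.

(* The boxes deleted by exhaustive elimination; [fixset] iterates from the empty
   set the operation adding all eliminable boxes. *)
Definition deleted : {set gbox (apex c)} :=
  fixset (fun D => [set b | elim_after D b]).

Lemma deletedE b : (b \in deleted) = elim_after deleted b.
Proof.
have mono : {homo (fun D => [set b | elim_after D b]) : X Y / X \subset Y}.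
  move=> X Y /subsetP XY; apply/subsetP => b'; rewrite !inE.
  apply: sub_all => w /andP[-> /forallP wX]; apply/forallP => b''.
  by apply/implyP => nY; apply: (implyP (wX b'')); apply: contra nY; apply: XY.
by rewrite {1}/deleted -(fixsetK mono) inE.
Qed.

Definition kept : pred (gwire (apex c)) :=
  fun w => [forall b in deleted, w \notin gout b].

Lemma kept_gin b w : b \notin deleted -> w \in gin b -> kept w.
Proof.
move=> nb wb; apply/forall_inP => b'; rewrite deletedE => /allP b'P.
apply/negP => /b'P /andP[_ /forallP/(_ b)]; by rewrite nb wb.
Qed.

Lemma kept_rleg w : w \in rleg c -> kept w.
Proof.
move=> wr; apply/forall_inP => b; rewrite deletedE => /allP bP.
by apply/negP => /bP; rewrite wr.
Qed.

Lemma kept_notin b w : kept w -> w \in gout b -> b \notin deleted.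
Proof. by move=> /forall_inP kw wb; apply/negP => /kw; rewrite wb. Qed.

Hypothesis pre_c : premarkov c.

Lemma gout_inj (w : gwire (apex c)) (b b' : gbox (apex c)) :
  w \in gout b -> w \in gout b' -> b = b'.
Proof.
rewrite -!has_pred1 !has_count => wb wb'; apply/eqP/negPn/negP => nbb'.
have := pre_c.2 w; rewrite (bigD1 b) //= (bigD1 b') 1?eq_sym //= => eq1.
have : 1 < 1; last by [].
rewrite -{2}eq1 addnC -addnA -[2]/(1 + 1) leq_add //.
by rewrite -addnA (leq_trans wb') // leq_addr.
Qed.

Lemma kept_gout b w : b \notin deleted -> w \in gout b -> kept w.
Proof.
move=> nb wb; apply/forall_inP => b' b'D; apply/negP => wb'.
by move: nb; rewrite (gout_inj wb wb') b'D.
Qed.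

Lemma kept_lleg w : w \in lleg c -> kept w.
Proof.
by move=> wl; apply/forall_inP => b _; apply/negP => /(lleg_gout pre_c wl).
Qed.

Definition norm_wire : Type := {w | kept w}.
Definition norm_box : Type := {b | b \in ~: deleted}.

(* The entries of s, all of which are kept in the uses below. *)
Definition restrict (s : seq (gwire (apex c))) : seq norm_wire := pmap insub s.

Lemma restrictK s : {in s, forall w, kept w} -> map val (restrict s) = s.
Proof.
move=> ks; rewrite (pmap_filter (insubK _)); apply/all_filterP/allP => w /ks kw.
by rewrite insubT.
Qed.

Lemma restrict_lab s : {in s, forall w, kept w} ->
  map (fun w : norm_wire => wlab (val w)) (restrict s) = map wlab s.
Proof. by move=> ks; rewrite -[in RHS](restrictK ks) -map_comp. Qed.

Lemma norm_boxP (b : norm_box) : val b \notin deleted.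
Proof. by have := valP b; rewrite inE. Qed.

Definition norm_graph : graph S :=
  @Graph S norm_wire norm_box
    (fun b => restrict (gin (val b))) (fun b => restrict (gout (val b)))
    (fun w => wlab (val w)) (fun b => blab (val b))
    (fun b => etrans (restrict_lab (fun w => kept_gin (norm_boxP b)))
                     (gin_lab (val b)))
    (fun b => etrans (restrict_lab (fun w => kept_gout (norm_boxP b)))
                     (gout_lab (val b))).

Definition norm_cospan : cospan m n :=
  @Cospan m n norm_graph (restrict (lleg c)) (restrict (rleg c))
    (etrans (restrict_lab kept_lleg) (lleg_lab c))
    (etrans (restrict_lab kept_rleg) (rleg_lab c)).

Lemma mem_restrict (w : norm_wire) s : (w \in restrict s) = (val w \in s).
Proof. exact: mem_pmap_sub. Qed.

Lemma count_restrict (w : norm_wire) s :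
  count_mem w (restrict s) = count_mem (val w) s.
Proof.
elim: s => //= x s IHs; rewrite /restrict /=; case: insubP => /= [y ky <-|nk].
  by rewrite IHs val_eqE.
rewrite IHs; case: eqP => // xw; move: nk.
by rewrite xw (valP w).
Qed.

Lemma norm_acyclic : acyclic norm_graph.
Proof.
have /acyclicP[r r_lt] := pre_c.1; apply/acyclicP; exists (fun w => r (val w)).
move=> w w' /existsP[b]; rewrite !mem_restrict => wb.
by apply: r_lt; apply/existsP; exists (val b).
Qed.

Lemma norm_left_monogamous : left_monogamous norm_cospan.
Proof.
move=> w; rewrite -(pre_c.2 (val w)) /= count_restrict; congr (_ + _).
under eq_bigr => b _ do rewrite count_restrict.
rewrite -(big_sub (mem (~: deleted)) (fun b => count_mem (val w) (gout b))).
rewrite [RHS](bigID (fun b => b \in ~: deleted)) /=.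
rewrite [X in _ = _ + X]big1 ?addn0 // => b; rewrite inE negbK => bD.
by apply/count_memPn; apply: (forall_inP (valP w)).
Qed.

Lemma norm_premarkov : premarkov norm_cospan.
Proof. by split; [apply: norm_acyclic | apply: norm_left_monogamous]. Qed.

End Normalization.

Lemma norm_normal m n (c : cospan m n) (pre_c : premarkov c) b :
  ~~ @eliminable m n (norm_cospan pre_c) b.
Proof.
apply/negP => /allP elb; have := norm_boxP b; rewrite deletedE => /negP; apply.
apply/allP => w wb; have kw := kept_gout pre_c (norm_boxP b) wb.
have := elb (exist _ w kw); rewrite /= !mem_restrict => /(_ wb) /andP[-> nin] /=.
apply/forallP => b'; apply/implyP => nb'; have b'P : b' \in ~: deleted c by rewrite inE.
have := forallP nin (exist _ b' b'P); rewrite inE /=.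
by rewrite mem_restrict.
Qed.

(* A Markov string diagram before passing to isomorphism classes. *)
Record diagram (m n : seq (wire S)) := Diagram {
  diag :> cospan m n;
  diag_pre : premarkov diag;
  diag_normal : forall b, ~~ @eliminable m n diag b
}.

Definition norm m n (c : cospan m n) (pre_c : premarkov c) : diagram m n :=
  Diagram (norm_premarkov pre_c) (@norm_normal m n c pre_c).

Section Composition.
Variables (m n k : seq (wire S)) (c : cospan m n) (d : cospan n k).

Lemma comp_lab : map wlab (rleg c) = map wlab (lleg d).
Proof. by rewrite rleg_lab lleg_lab. Qed.

Definition cospan_comp : cospan m k :=
  @Cospan m k (pushout comp_lab)
    (map (push_inl comp_lab) (lleg c))
    (map (push_inr comp_lab) (rleg d))
    (etrans (push_inl_lab comp_lab (lleg c)) (lleg_lab c))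
    (etrans (push_inr_lab comp_lab (rleg d)) (rleg_lab d)).

Hypotheses (pre_c : premarkov c) (pre_d : premarkov d).

Definition comp_rho (x : gwire (gsum (apex c) (apex d))) :
    gwire (gsum (apex c) (apex d)) :=
  match x with
  | inl a => inl a
  | inr b => oapp inl (inr b) (onth (rleg c) (index b (lleg d)))
  end.

Lemma comp_size : size (rleg c) = size (lleg d).
Proof. by rewrite -(size_map wlab) comp_lab size_map. Qed.

Lemma comp_rho_glue x y :
  (x, y) \in push_pairs (rleg c) (lleg d) -> comp_rho x = comp_rho y.
Proof.
by case/push_pairsP=> i [a [b [ia ib -> ->]]] /=; rewrite (index_lleg pre_d ib) ia.
Qed.

Lemma comp_glue_rho x :
  connect (glue (push_pairs (rleg c) (lleg d))) x (comp_rho x).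
Proof.
case: x => [a|b] /=; first exact: connect0.
case ia: (onth (rleg c) _) => [a|] /=; last exact: connect0.
apply: connect1; apply/orP; right; apply/push_pairsP.
exists (index b (lleg d)), a, b; split=> //.
have : index b (lleg d) < size (lleg d) by rewrite -comp_size -onthTE ia.
case ib: (onth (lleg d) _) => [b'|]; last by rewrite -onthTE ib.
by rewrite index_mem => /(nth_index b) bE; rewrite -(onth_nth b _ _ _ ib) bE.
Qed.

Lemma comp_rho_inr b : b \notin lleg d -> comp_rho (inr b) = inr b.
Proof.
by move=> nb; rewrite /= onth_default // comp_size leqNgt index_mem.
Qed.

Lemma comp_premarkov : premarkov cospan_comp.
Proof.
split.
  have [r1 [r1_lt r1_le]] := acyclic_rank pre_c.1.
  have [r2 [r2_lt _]] := acyclic_rank pre_d.1.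
  pose r (x : gwire (gsum (apex c) (apex d))) :=
    match x with inl a => r1 a | inr b => #|gwire (apex c)| + r2 b end.
  apply: (gquot_acyclic comp_rho_glue comp_glue_rho (r := r)) => -[a|b] [a'|b'].
  - by rewrite succ_sum_ll; apply: r1_lt.
  - by rewrite succ_sum_lr.
  - by rewrite succ_sum_rl.
  rewrite succ_sum_rr => bb'; rewrite (comp_rho_inr (b := b')) /=; last first.
    by apply/negP => /(succ_lleg pre_d bb').
  case: onth => [a|] /=; last by rewrite ltn_add2l r2_lt.
  apply: leq_ltn_trans (r1_le a) _; rewrite -[X in X < _]addn0 ltn_add2l.
  exact: leq_ltn_trans (r2_lt _ _ bb').
pose p : seq (gwire (gsum (apex c) (apex d))) :=
  map inl (lleg c) ++ map inr [::].
have pE : lleg cospan_comp = map (cls (push_pairs (rleg c) (lleg d))) p.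
  by rewrite /p cats0 -map_comp.
move=> w; rewrite -[LHS]/(indeg (lleg cospan_comp) w) pE.
apply: (gquot_indeg comp_rho_glue comp_glue_rho) => x.
case: x => [a|b]; first by rewrite indeg_suml /= eqxx; apply: (pre_c.2).
rewrite indeg_sumr; have := pre_d.2 b.
have [bl|nbl] := boolP (b \in lleg d); last first.
  by rewrite comp_rho_inr // eqxx (count_memPn nbl).
rewrite count_uniq_mem ?(lleg_uniq pre_d) // bl => -[] /eqP.
rewrite -[X in X == 0]/(indeg [::] b) => /eqP -> /=.
case: (onth _ _) (onthTE (rleg c) (index b (lleg d))) => [a|] //=.
by rewrite comp_size index_mem bl.
Qed.

End Composition.

Section Wiring.
Variables (m n : seq (wire S)) (q : seq 'I_(size m)).
Hypothesis q_lab : map (tnth (in_tuple m)) q = n.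

(* The diagram without boxes whose j-th output is the input number q_j. *)
Definition wiring_cospan : cospan m n :=
  @Cospan m n (discrete m) (enum 'I_(size m)) q
    (map_tnth_enum (in_tuple m)) q_lab.

Lemma succ_discrete x y : succ (discrete m) x y = false.
Proof. by apply/existsP => -[[]]. Qed.

Lemma connect_discrete x y : connect (succ (discrete m)) x y = (x == y).
Proof.
apply/connectP/eqP => [[[|z s] /=] | ->]; [by [] | | by exists [::]].
by rewrite succ_discrete.
Qed.

Lemma wiring_premarkov : premarkov wiring_cospan.
Proof.
split; first by apply/acyclicP; exists (fun=> 0) => x y; rewrite succ_discrete.
move=> w; rewrite big1 => [|[]] //=.
by rewrite addn0 count_uniq_mem ?enum_uniq ?mem_enum.
Qed.

Lemma wiring_normal b : ~~ @eliminable m n wiring_cospan b.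
Proof. by case: b. Qed.

Definition wiring : diagram m n := Diagram wiring_premarkov wiring_normal.

End Wiring.

Section Tensor.
Variables (m n m' n' : seq (wire S)) (c : diagram m n) (d : diagram m' n').

Lemma tens_lab s t :
  map (@wlab S (gsum (apex c) (apex d))) (map inl s ++ map inr t) =
  map wlab s ++ map wlab t.
Proof. by rewrite map_cat -!map_comp. Qed.

Lemma tens_llab :
  map (@wlab S (gsum (apex c) (apex d)))
    (map inl (lleg c) ++ map inr (lleg d)) = m ++ m'.
Proof. by rewrite tens_lab !lleg_lab. Qed.

Lemma tens_rlab :
  map (@wlab S (gsum (apex c) (apex d)))
    (map inl (rleg c) ++ map inr (rleg d)) = n ++ n'.
Proof. by rewrite tens_lab !rleg_lab. Qed.

Definition tens_cospan : cospan (m ++ m') (n ++ n') :=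
  Cospan tens_llab tens_rlab.

Lemma tens_premarkov : premarkov tens_cospan.
Proof.
have [[/acyclicP[r r_lt] mc] [/acyclicP[r' r'_lt] md]] := (diag_pre c, diag_pre d).
split.
  apply/acyclicP; exists (fun x => match x with inl a => r a | inr b => r' b end).
  move=> [a|b] [a'|b']; rewrite ?succ_sum_lr ?succ_sum_rl //.
    by rewrite succ_sum_ll; apply: r_lt.
  by rewrite succ_sum_rr; apply: r'_lt.
case=> [a|b]; first by apply: etrans (indeg_suml _ _ _) _; apply: mc.
by apply: etrans (indeg_sumr _ _ _) _; apply: md.
Qed.

Lemma tens_normal b : ~~ eliminable (c := tens_cospan) b.
Proof.
case: b => b; [have := diag_normal b | have := diag_normal b].
  apply: contra => /allP elb; apply/allP => w wb.
  have := elb (inl w); rewrite /= mem_map ?wb; last exact: inl_inj.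
  rewrite mem_cat (mem_map (@inl_inj _ (gwire (apex d)))) negb_or.
  case/(_ isT)/andP=> /andP[-> _] /forallP nin /=.
  apply/forallP => b'; have := nin (inl b'); rewrite !inE /=.
  by rewrite (mem_map (@inl_inj _ (gwire (apex d)))).
apply: contra => /allP elb; apply/allP => w wb.
have := elb (inr w); rewrite /= mem_map ?wb; last exact: inr_inj.
rewrite mem_cat (mem_map (@inr_inj (gwire (apex c)) _)) negb_or.
case/(_ isT)/andP=> /andP[_ ->] /forallP nin /=.
apply/forallP => b'; have := nin (inr b'); rewrite !inE /=.
by rewrite (mem_map (@inr_inj (gwire (apex c)) _)).
Qed.

Definition diag_tens : diagram (m ++ m') (n ++ n') :=
  Diagram tens_premarkov tens_normal.

End Tensor.

Definition diag_comp m n k (d : diagram n k) (c : diagram m n) : diagram m k :=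
  norm (comp_premarkov (diag_pre c) (diag_pre d)).

Section Contraction.
Variables (m n w : seq (wire S)) (c : cospan (m ++ w) (n ++ w)).

Definition leg_i := take (size m) (lleg c).
Definition leg_i' := drop (size m) (lleg c).
Definition leg_j := take (size n) (rleg c).
Definition leg_j' := drop (size n) (rleg c).

Lemma leg_i_lab : map wlab leg_i = m.
Proof. by rewrite map_take lleg_lab take_size_cat. Qed.

Lemma leg_i'_lab : map wlab leg_i' = w.
Proof. by rewrite map_drop lleg_lab drop_size_cat. Qed.

Lemma leg_j_lab : map wlab leg_j = n.
Proof. by rewrite map_take rleg_lab take_size_cat. Qed.

Lemma leg_j'_lab : map wlab leg_j' = w.
Proof. by rewrite map_drop rleg_lab drop_size_cat. Qed.

Definition wires : seq (gwire (discrete w)) := enum 'I_(size w).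

Lemma contr_lab : map wlab (leg_i' ++ leg_j') = map wlab (wires ++ wires).
Proof.
by rewrite !map_cat leg_i'_lab leg_j'_lab (map_tnth_enum (in_tuple w)).
Qed.

(* The pushout of [i', j'] along the codiagonal of w, before normalization. *)
Definition contr_cospan : cospan m n :=
  @Cospan m n (pushout contr_lab)
    (map (push_inl contr_lab) leg_i) (map (push_inl contr_lab) leg_j)
    (etrans (push_inl_lab contr_lab leg_i) leg_i_lab)
    (etrans (push_inl_lab contr_lab leg_j) leg_j_lab).

Hypothesis pre_c : premarkov c.
Hypothesis no_loop :
  forall x y, x \in leg_i' -> y \in leg_j' -> ~~ connect (succ (apex c)) x y.

Lemma size_leg_i' : size leg_i' = size w.
Proof. by rewrite -(size_map wlab) leg_i'_lab. Qed.

Lemma size_leg_j' : size leg_j' = size w.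
Proof. by rewrite -(size_map wlab) leg_j'_lab. Qed.

Lemma onth_wires (k : nat) (k' : 'I_(size w)) :
  onth wires k = Some k' <-> k = k'.
Proof.
have sz : size wires = size w by rewrite size_enum_ord.
split=> [kk' | ->].
  have lt_k : k < size w by rewrite -sz -onthTE kk'.
  by rewrite -(onth_nth k' _ _ _ kk') nth_enum_ord.
have : onth wires k' by rewrite onthTE sz.
case kE: onth => [k0|] // _; congr Some; apply: val_inj.
by rewrite -(onth_nth k0 _ _ _ kE) /= nth_enum_ord.
Qed.

Lemma leg_i'_uniq : uniq leg_i'.
Proof. exact: drop_uniq (lleg_uniq pre_c). Qed.

Lemma leg_j'_notin y : y \in leg_j' -> y \notin leg_i'.
Proof. by move=> yj; apply/negP => /no_loop/(_ yj); rewrite connect0. Qed.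

Definition contr_rho (x : gwire (gsum (apex c) (discrete w))) :
    gwire (gsum (apex c) (discrete w)) :=
  match x with
  | inl a => oapp inl (inl a) (onth leg_j' (index a leg_i'))
  | inr k => oapp inl (inr k) (onth leg_j' k)
  end.

Lemma contr_rho_id a : a \notin leg_i' -> contr_rho (inl a) = inl a.
Proof.
by move=> na; rewrite /= onth_default // size_leg_j' -size_leg_i' leqNgt index_mem.
Qed.

Lemma contr_pairs a (k : 'I_(size w)) :
  ((inl a, inr k) \in push_pairs (leg_i' ++ leg_j') (wires ++ wires)) <->
  onth leg_i' k = Some a \/ onth leg_j' k = Some a.
Proof.
have szw : size wires = size w by rewrite size_enum_ord.
split=> [/push_pairsP[t [a' [k' [ta tk [aE] [kE]]]]] | ].
  move: ta tk; rewrite -aE -kE !onth_cat size_leg_i' szw.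
  by case: ltnP => _ ta /onth_wires <-; [left | right].
case=> ka; apply/push_pairsP.
  exists (k : nat), a, k; rewrite !onth_cat size_leg_i' szw !ltn_ord.
  by split=> //; apply/onth_wires.
exists (size w + k), a, k; rewrite !onth_cat size_leg_i' szw.
by rewrite ltnNge leq_addr /= addKn; split=> //; apply/onth_wires.
Qed.

Lemma contr_rho_glue x y :
  (x, y) \in push_pairs (leg_i' ++ leg_j') (wires ++ wires) ->
  contr_rho x = contr_rho y.
Proof.
move=> xy; have [t [a [k [_ _ xE yE]]]] := (push_pairsP _ _ _ _).1 xy.
move: xy; rewrite {x}xE {y}yE => /contr_pairs[] ka; last first.
  rewrite contr_rho_id /= ?ka //; apply: leg_j'_notin; apply/onthP.
  by exists k.
have idx : index a leg_i' = k.
  by rewrite -{1}(onth_nth a _ _ _ ka) index_uniq ?leg_i'_uniq // size_leg_i'.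
rewrite /= idx; have : onth leg_j' k by rewrite onthTE size_leg_j'.
by case: onth.
Qed.

Lemma contr_glue_rho x :
  connect (glue (push_pairs (leg_i' ++ leg_j') (wires ++ wires))) x (contr_rho x).
Proof.
case: x => [a|k] /=; case jE: onth => [y|] /=; rewrite ?connect0 //; last first.
  by apply: connect1; apply/orP; right; apply/contr_pairs; right.
have lt_a : index a leg_i' < size w by rewrite -size_leg_j' -onthTE jE.
have ai : a \in leg_i' by rewrite -index_mem size_leg_i'.
have ia : onth leg_i' (index a leg_i') = Some a.
  have : onth leg_i' (index a leg_i') by rewrite onthTE size_leg_i'.
  case aE: onth => [a'|] // _.
  by rewrite -(onth_nth a _ _ _ aE) nth_index.
apply: (@connect_trans _ _ (inr (Ordinal lt_a))); apply: connect1; apply/orP.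
  by left; apply/contr_pairs; left.
by right; apply/contr_pairs; right.
Qed.

Lemma contr_premarkov : premarkov contr_cospan.
Proof.
split.
  have [r [r_lt r_le]] := acyclic_rank pre_c.1.
  pose rch a := [exists x in leg_i', connect (succ (apex c)) x a].
  pose R (x : gwire (gsum (apex c) (discrete w))) :=
    match x with
    | inl a => (if rch a then #|gwire (apex c)| else 0) + r a
    | inr k => 0
    end.
  apply: (gquot_acyclic contr_rho_glue contr_glue_rho (r := R)) => -[a|b] [a'|b'];
    rewrite ?succ_sum_lr ?succ_sum_rl ?succ_sum_rr ?succ_discrete // succ_sum_ll.
  move=> aa'; rewrite (contr_rho_id (a := a')); last first.
    by apply/negP => /mem_drop /(succ_lleg pre_c aa').
  have [ai|nai] := boolP (a \in leg_i'); last first.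
    rewrite contr_rho_id // -addnS leq_add ?r_lt //.
    case: ifP => // /exists_inP[x xi xa]; rewrite ifT //.
    by apply/exists_inP; exists x => //; apply: connect_trans xa (connect1 aa').
  have ra' : rch a' by apply/exists_inP; exists a => //; apply: connect1.
  have /= : onth leg_j' (index a leg_i').
    by rewrite onthTE size_leg_j' -size_leg_i' index_mem.
  case yE: onth => [y|] //= _; rewrite ra' ifF.
    rewrite add0n (leq_ltn_trans (r_le y)) // -[X in X < _]addn0 ltn_add2l.
    exact: leq_ltn_trans (r_lt _ _ aa').
  apply/negbTE/negP; rewrite /rch => /exists_inP[x xi xy]; have yj : y \in leg_j'.
    by apply/onthP; exists (index a leg_i').
  by have := no_loop xi yj; rewrite xy.
pose p : seq (gwire (gsum (apex c) (discrete w))) := map inl leg_i ++ map inr [::].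
have pE : lleg contr_cospan =
    map (cls (push_pairs (leg_i' ++ leg_j') (wires ++ wires))) p.
  by rewrite /p cats0 -map_comp.
move=> x; rewrite -[LHS]/(indeg (lleg contr_cospan) x) pE.
apply: (gquot_indeg contr_rho_glue contr_glue_rho) => -[a|k]; last first.
  rewrite indeg_sumr /= /indeg big1 /= => [|[]] //.
  have : onth leg_j' k by rewrite onthTE size_leg_j'.
  by case: onth.
rewrite indeg_suml; have := pre_c.2 a; rewrite -{1}(cat_take_drop (size m) (lleg c)).
rewrite count_cat -/leg_i -/leg_i' addnAC.
rewrite -[X in X + _]/(indeg leg_i a); have [ai|nai] := boolP (a \in leg_i'); last first.
  by rewrite (count_memPn nai) contr_rho_id // eqxx addn0.
rewrite count_uniq_mem ?leg_i'_uniq // ai addn1 => -[->] /=.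
have : onth leg_j' (index a leg_i').
  by rewrite onthTE size_leg_j' -size_leg_i' index_mem.
case yE: onth => [y|] //= _; case: eqP => // -[ya].
have := leg_j'_notin (y := y); rewrite {2}ya ai => /(_ _)/negP[] //.
by apply/onthP; exists (index a leg_i').
Qed.

End Contraction.

Definition cospan_iso m n (c d : cospan m n) : Prop :=
  exists (f : gwire (apex c) -> gwire (apex d))
         (g : gbox (apex c) -> gbox (apex d)),
  [/\ bijective f /\ bijective g,
      (forall w, wlab (f w) = wlab w) /\ (forall b, blab (g b) = blab b),
      (forall b, gin (g b) = map f (gin b)) /\
      (forall b, gout (g b) = map f (gout b)),
      lleg d = map f (lleg c) & rleg d = map f (rleg c)].

Lemma cospan_iso_refl m n (c : cospan m n) : cospan_iso c c.
Proof.
exists id, id; split; rewrite ?map_id //; first by split; exists id.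
by split=> b; rewrite map_id.
Qed.

Lemma cospan_iso_sym m n (c d : cospan m n) : cospan_iso c d -> cospan_iso d c.
Proof.
case=> f [g [[[f' fK f'K] [g' gK g'K]] [fl gl] [gi go] ll rl]].
exists f', g'; split.
- by split; [exists f | exists g].
- by split=> x; [rewrite -{2}[x]f'K fl | rewrite -{2}[x]g'K gl].
- by split=> b; rewrite -{2}[b]g'K ?gi ?go mapK.
- by rewrite ll mapK.
- by rewrite rl mapK.
Qed.

Lemma cospan_iso_trans m n (c d e : cospan m n) :
  cospan_iso c d -> cospan_iso d e -> cospan_iso c e.
Proof.
case=> f [g [[bf bg] [fl gl] [gi go] ll rl]].
case=> f' [g' [[bf' bg'] [fl' gl'] [gi' go'] ll' rl']].
exists (f' \o f), (g' \o g); split.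
- by split; apply: bij_comp.
- by split=> x /=; rewrite ?fl' ?gl'.
- by split=> b /=; rewrite ?gi' ?go' ?gi ?go map_comp.
- by rewrite ll' ll map_comp.
- by rewrite rl' rl map_comp.
Qed.

(* Markov string diagrams: isomorphism classes of cospans.  [eq_quot] is not
   available here, as [diagram] is too large to be the sort of an eqType. *)
Definition string_diagram m n : Type :=
  {P : diagram m n -> Prop | exists c : diagram m n, P = fun d => cospan_iso c d}.

Definition diag_class m n (c : diagram m n) : string_diagram m n :=
  exist _ (fun d : diagram m n => cospan_iso c d) (ex_intro _ c erefl).

Definition diag_repr m n (f : string_diagram m n) : diagram m n :=
  projT1 (cid (proj2_sig f)).

Lemma diag_classP m n (c d : diagram m n) :
  diag_class c = diag_class d <-> cospan_iso c d.
Proof.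
split=> [/(congr1 (@proj1_sig _ _))/(congr1 (fun P => P d)) /= -> | cd].
  exact: cospan_iso_refl.
apply: eq_exist; apply/funext => e; apply/propext; split.
  exact/cospan_iso_trans/cospan_iso_sym.
exact: cospan_iso_trans.
Qed.

Lemma diag_reprK m n (f : string_diagram m n) : diag_class (diag_repr f) = f.
Proof.
by case: f => P exP; apply: eq_exist; rewrite /diag_repr; case: cid => c /= <-.
Qed.

Lemma diag_repr_iso m n (c : diagram m n) : cospan_iso (diag_repr (diag_class c)) c.
Proof. by apply/diag_classP; rewrite diag_reprK. Qed.

Definition sd_wiring m n (q : seq 'I_(size m))
    (q_lab : map (tnth (in_tuple m)) q = n) : string_diagram m n :=
  diag_class (wiring q_lab).

Definition sd_comp m n k (g : string_diagram n k) (f : string_diagram m n) :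
    string_diagram m k :=
  diag_class (diag_comp (diag_repr g) (diag_repr f)).

Definition sd_tens m n m' n' (f : string_diagram m n) (g : string_diagram m' n') :
    string_diagram (m ++ m') (n ++ n') :=
  diag_class (diag_tens (diag_repr f) (diag_repr g)).

Section Structure.
Implicit Types m n k : seq (wire S).

Definition ords m : seq 'I_(size m) := enum 'I_(size m).

Lemma ords_lab m n : m = n -> map (tnth (in_tuple m)) (ords m) = n.
Proof. by move=> <-; apply: map_tnth_enum (in_tuple m). Qed.

(* The identity, also used for the coherence isomorphisms. *)
Definition sd_cast m n (mn : m = n) : string_diagram m n :=
  sd_wiring (ords_lab mn).

Lemma swap_lab m n :
  map (tnth (in_tuple (m ++ n)))
    (drop (size m) (ords (m ++ n)) ++ take (size m) (ords (m ++ n))) = n ++ m.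
Proof.
rewrite map_cat map_drop map_take (ords_lab (erefl (m ++ n))).
by rewrite take_size_cat ?drop_size_cat.
Qed.

Lemma copy_lab m : map (tnth (in_tuple m)) (ords m ++ ords m) = m ++ m.
Proof. by rewrite map_cat (ords_lab (erefl m)). Qed.

Definition sd_swap m n : string_diagram (m ++ n) (n ++ m) :=
  sd_wiring (swap_lab m n).

Definition sd_copy m : string_diagram m (m ++ m) := sd_wiring (copy_lab m).

Definition sd_del m : string_diagram m [::] :=
  @sd_wiring m [::] [::] erefl.

End Structure.

Definition free_markov : markov_data :=
  @MarkovData (seq (wire S)) string_diagram
    (fun m => sd_cast (erefl m)) (fun m n k => @sd_comp m n k)
    [::] (fun m n => m ++ n) sd_tens
    (fun m n k => sd_cast (esym (catA m n k)))
    (fun m n k => sd_cast (catA m n k))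
    (fun m => sd_cast (cat0s m)) (fun m => sd_cast (esym (cat0s m)))
    (fun m => sd_cast (cats0 m)) (fun m => sd_cast (esym (cats0 m)))
    sd_swap sd_copy sd_del.

Definition reach m n (c : cospan m n) (k l : nat) : Prop :=
  exists x y, [/\ onth (lleg c) k = Some x, onth (rleg c) l = Some y &
                  connect (succ (apex c)) x y].

Lemma homo_connect G H (f : gwire G -> gwire H) x y :
  {homo f : x y / succ G x y >-> connect (succ H) x y} ->
  connect (succ G) x y -> connect (succ H) (f x) (f y).
Proof.
move=> f_homo /connectP[s]; elim: s x => [|t s IHs] x /=.
  by move=> _ ->; apply: connect0.
by case/andP=> /f_homo xt /IHs{}IHs /IHs; apply: connect_trans.
Qed.

Lemma reach_iso m n (c d : cospan m n) k l :
  cospan_iso c d -> reach c k l -> reach d k l.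
Proof.
case=> f [g [_ _ [gi go] ll rl]] [x [y [kx ly xy]]].
exists (f x), (f y); rewrite ll rl !onth_map kx ly; split=> //.
apply: homo_connect xy => x' y' /existsP[b /andP[xb yb]].
apply: connect1; apply/existsP; exists (g b).
by rewrite gi go !map_f.
Qed.

Lemma reach_repr m n (c : diagram m n) k l :
  reach (diag_repr (diag_class c)) k l <-> reach c k l.
Proof.
split; apply: reach_iso; first exact: diag_repr_iso.
exact/cospan_iso_sym/diag_repr_iso.
Qed.

Lemma kept_connect m n (c : cospan m n) (x y : gwire (apex c)) :
  connect (succ (apex c)) x y -> kept y -> kept x.
Proof.
move=> /connectP[s ps ->]; elim: s x ps => [|t s IHs] x //=.
case/andP=> /existsP[b /andP[xb tb]] /IHs{}IHs /IHs kt.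
exact: kept_gin (kept_notin kt tb) xb.
Qed.

Lemma connect_norm m n (c : cospan m n) (pre_c : premarkov c)
    (x y : gwire (norm_graph pre_c)) :
  connect (succ _) x y = connect (succ (apex c)) (val x) (val y).
Proof.
apply/idP/idP => [|/connectP[s]].
  apply: homo_connect => x' y' /existsP[b]; rewrite !mem_restrict => xb.
  by apply: connect1; apply/existsP; exists (val b).
elim: s x => [|t s IHs] x /=.
  by move=> _ /val_inj ->; apply: connect0.
case/andP=> xt ts ty.
have kt : kept t.
  by apply: kept_connect (valP y); apply/connectP; exists s.
apply: connect_trans (IHs (exist _ t kt) ts ty); apply: connect1.
case/existsP: xt => b /andP[xb tb].
have bP : b \in ~: deleted c by rewrite inE; apply: kept_notin tb.
by apply/existsP; exists (exist _ b bP); rewrite !mem_restrict /= xb.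
Qed.

Lemma reach_norm m n (c : cospan m n) (pre_c : premarkov c) k l :
  reach (norm pre_c) k l <-> reach c k l.
Proof.
have kl := restrictK (kept_lleg pre_c); have kr := restrictK (@kept_rleg _ _ c).
split=> [[x [y [kx ly]]] | [x [y []]]].
  rewrite connect_norm => xy; exists (val x), (val y).
  by rewrite -kl -kr !onth_map kx ly.
rewrite -{1}kl -{1}kr !onth_map.
case kx: onth => [x'|] //= [<-]; case ly: onth => [y'|] //= [<-] xy.
by exists x', y'; split=> //; rewrite connect_norm.
Qed.

Section CompReach.
Variables (m n k : seq (wire S)) (c : cospan m n) (d : cospan n k).
Hypotheses (pre_c : premarkov c) (pre_d : premarkov d).

Local Notation il := (push_inl (comp_lab c d)).
Local Notation ir := (push_inr (comp_lab c d)).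

Lemma push_inl_inj : injective il.
Proof.
move=> a a'; rewrite /push_inl.
by move/(cls_rho (comp_rho_glue pre_d) (@comp_glue_rho _ _ _ c d)) => -[].
Qed.

Lemma push_inlr a b :
  il a = ir b <-> exists j, onth (rleg c) j = Some a /\ onth (lleg d) j = Some b.
Proof.
split=> [|[j [ja jb]]]; last first.
  apply/clsP; apply: connect1; apply/orP; left; apply/push_pairsP.
  by exists j, a, b.
move/(cls_rho (comp_rho_glue pre_d) (@comp_glue_rho _ _ _ c d)) => /=.
case ia: onth => [a'|] //= [->]; exists (index b (lleg d)); split=> //.
have : onth (lleg d) (index b (lleg d)) by rewrite onthTE -(comp_size c d) -onthTE ia.
case ib: onth => [b'|] // _; rewrite -(onth_nth b _ _ _ ib) nth_index //.
by rewrite -index_mem -(comp_size c d) -onthTE ia.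
Qed.

Lemma push_inr_inj b b' : b \notin lleg d -> ir b = ir b' -> b = b'.
Proof.
move=> nb; move/(cls_rho (comp_rho_glue pre_d) (@comp_glue_rho _ _ _ c d)).
by rewrite comp_rho_inr //=; case: onth => [a|] //= -[].
Qed.

Lemma reach_comp i l :
  reach (cospan_comp c d) i l <-> exists j, reach c i j /\ reach d j l.
Proof.
split=> [[z [z' []]] | [j [[x [y [ix jy xy]]] [x' [y' [jx' ly' xy']]]]]]; last first.
  exists (il x), (ir y'); rewrite /= !onth_map ix ly'; split=> //.
  apply: (@connect_trans _ _ (il y)).
    apply: homo_connect xy => a b /existsP[e /andP[ae be]]; apply: connect1.
    by apply/existsP; exists (inl e); rewrite /= -!map_comp !map_f.
  have -> : il y = ir x' by apply/push_inlr; exists j.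
  apply: homo_connect xy' => a b /existsP[e /andP[ae be]]; apply: connect1.
  by apply/existsP; exists (inr e); rewrite /= -!map_comp !map_f.
rewrite /= !onth_map; case ix: (onth _ i) => [x|] //= [<-].
case ly: (onth _ l) => [y|] //= [<-] /connectP[s].
pose Z z := (forall a, z = il a -> connect (succ (apex c)) x a) /\
  (forall b, z = ir b -> exists j q p,
     [/\ onth (rleg c) j = Some q, onth (lleg d) j = Some p,
        connect (succ _) x q & connect (succ _) p b]).
have Zx : Z (il x).
  split=> [a /push_inl_inj <- // | b /push_inlr[j [jx jb]]].
  by exists j, x, b.
have Zsucc t t' : succ (pushout (comp_lab c d)) t t' -> Z t -> Z t'.
  case/existsP=> -[e|e] /= /andP[]; rewrite -!map_comp.
    case/mapP=> a1 e1 -> /mapP[a2 e2 ->] [/(_ a1 erefl) xa1 _].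
    have xa2 : connect (succ (apex c)) x a2.
      by apply: connect_trans xa1 (connect1 _); apply/existsP; exists e; rewrite e1.
    split=> [a /push_inl_inj <- // | b /push_inlr[j [ja jb]]].
    by exists j, a2, b.
  case/mapP=> b1 e1 -> /mapP[b2 e2 ->] [_ /(_ b1 erefl)[j [q [p [jq jp xq pb1]]]]].
  have b12 : succ (apex d) b1 b2 by apply/existsP; exists e; rewrite e1.
  have nb2 : b2 \notin lleg d by apply/negP => /(succ_lleg pre_d b12).
  split=> [a /esym/push_inlr[j' [_ jb]] | b /(push_inr_inj nb2) <-].
    by case/negP: nb2; apply/onthP; exists j'.
  by exists j, q, p; split=> //; apply: connect_trans pb1 (connect1 b12).
have : Z (il x) by [].
elim: s {Zx} (il x) => [|t s IHs] z0 /=.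
  move=> [_ Zr] _ zy; have [j [q [p [jq jp xq py]]]] := Zr y (esym zy).
  by exists j; split; [exists x, q | exists p, y].
by move=> Zz /andP[/Zsucc/(_ Zz)]; apply: IHs.
Qed.

End CompReach.

Lemma reach_wiring m n q (q_lab : map (tnth (in_tuple m)) q = n) k l :
  reach (wiring q_lab) k l <-> exists2 o : 'I_(size m), k = o & onth q l = Some o.
Proof.
split=> [[x [y [/onth_wires -> ly]]] | [o -> lo]].
  by rewrite connect_discrete => /eqP xy; exists x => //; rewrite ly xy.
by exists o, o; split; [apply/onth_wires | | apply: connect0].
Qed.

Lemma sd_reach_comp m n k (g : string_diagram n k) (f : string_diagram m n) i l :
  reach (diag_repr (sd_comp g f)) i l <->
  exists j, reach (diag_repr f) i j /\ reach (diag_repr g) j l.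
Proof.
apply: iff_trans (reach_repr _ _ _) _; apply: iff_trans (reach_norm _ _ _) _.
exact: reach_comp (diag_pre _) _ _.
Qed.

Lemma sd_reach_cast m n (mn : m = n) k l :
  reach (diag_repr (sd_cast mn)) k l <-> k = l /\ k < size m.
Proof.
apply: iff_trans (reach_repr _ _ _) _; apply: iff_trans (reach_wiring _ _ _) _.
split=> [[o -> /onth_wires ->] // | [<- km]].
by exists (Ordinal km) => //; apply/onth_wires.
Qed.

Lemma sd_reach_tens_r m n m' n' (f : string_diagram m n)
    (g : string_diagram m' n') k l :
  reach (diag_repr g) k l ->
  reach (diag_repr (sd_tens f g)) (size m + k) (size n + l).
Proof.
case=> x [y [kx ly xy]]; apply/reach_repr; exists (inr x), (inr y).
rewrite /= !onth_cat !size_map -(size_map wlab (lleg _)) lleg_lab.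
rewrite -(size_map wlab (rleg _)) rleg_lab !ltnNge !leq_addr /= !addKn !onth_map.
rewrite kx ly; split=> //.
apply: (@homo_connect (apex _) (gsum _ (apex _)) inr) xy => a b ab.
by apply: connect1; rewrite succ_sum_rr.
Qed.

Lemma sd_reach_tens_del m n w (f : string_diagram m n) k l :
  ~ reach (diag_repr (sd_tens f (sd_del w))) (size m + k) l.
Proof.
move/reach_repr => [x [y []]] /=; have := rleg_lab (diag_repr (sd_del w)).
move/(congr1 size); rewrite size_map => /size0nil -> /=.
rewrite cats0 onth_cat onth_map !size_map -(size_map wlab (lleg _)) lleg_lab.
rewrite ltnNge leq_addr /= addKn !onth_map; case: (onth (lleg (diag_repr (sd_del w))) k) => //= a [<-].
case: (onth (rleg (diag_repr f)) l) => //= b [<-] /connectP[s].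
elim: s a => [|[t|t] s IHs] a //=; first by rewrite succ_sum_rl.
by case/andP=> _; apply: IHs.
Qed.

(* In a non-signalling diagram no input of the feedback wires reaches one of the
   corresponding outputs, so that contraction creates no cycle. *)
Lemma nonsignalling_no_loop m n w (f : string_diagram (m ++ w) (n ++ w)) :
    @nonsignalling free_markov m w n w f ->
  forall x y, x \in leg_i' (diag_repr f) -> y \in leg_j' (diag_repr f) ->
    ~~ connect (succ _) x y.
Proof.
case=> g /= fg x y /onthP[a xa] /onthP[b yb]; apply/negP => xy.
have onth_drop T (s : seq T) i j : onth (drop i s) j = onth s (i + j).
  by elim: s i => [|z s IHs] [|i] //=; rewrite ?onth0n.
have f_ab : reach (diag_repr f) (size m + a) (size n + b).
  by exists x, y; rewrite -!onth_drop.
have lt_b : b < size w by rewrite -(size_leg_j' (diag_repr f)) -onthTE yb.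
have cast_b : reach (diag_repr (sd_cast (erefl w))) b b by apply/sd_reach_cast.
have : reach (diag_repr (sd_comp (sd_comp (sd_cast (cat0s w))
    (sd_tens (sd_del n) (sd_cast (erefl w)))) f)) (size m + a) b.
  apply/sd_reach_comp; exists (size n + b); split=> //.
  apply/sd_reach_comp; exists b; split; last exact/sd_reach_cast.
  exact: (sd_reach_tens_r (sd_del n) cast_b).
rewrite fg => /sd_reach_comp[j [+ _]]; exact: sd_reach_tens_del.
Qed.

Definition contr m n w
    (f : @hom free_markov (@tens_ob free_markov m w) (@tens_ob free_markov n w))
    (nsf : nonsignalling f) : @hom free_markov m n :=
  diag_class (norm (contr_premarkov (diag_pre (diag_repr f))
                                    (nonsignalling_no_loop nsf))).

End Graphs.

(* Main.v *)
(* A non-signalling diagram f : m (x) w -> n (x) w splits into an early part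
   f1 : m -> k (x) w, made of the boxes some output of which leads to an output
   wire of w, and a late part f2 : k (x) w -> n, made of the other boxes.  No
   input wire of w leads to an output wire of w, so the early part does not use
   the inputs w, and f is f1 and f2 composed around a swap of the two copies of
   w, while contr^w(f) = f2 o f1.  In C, tightening, superposition and yanking
   give the trace of such a composite around a swap as the plain composite. *)

From mathcomp Require Import all_boot.
From mathcomp Require Import boolp.
Require Import Defs.

Set Implicit Arguments.
Unset Strict Implicit.
Unset Printing Implicit Defensive.

Local Open Scope cat_scope.

Lemma inj_surj_bij (A B : finType) (f : A -> B) :
  injective f -> (forall y, exists x, y = f x) -> bijective f.
Proof.
move=> f_inj /choice[g fg]; exists g => [x|y]; last by rewrite -fg.
by apply: f_inj; rewrite -fg.
Qed.

(** * Traces of composites around a swap *)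

Section MarkovCategories.
Variables (C : markov_category) (T : causal_traces C).

Lemma compA (x y z t : ob C) (h : hom z t) (g : hom y z) (f : hom x y) :
  h \;o (g \;o f) = h \;o g \;o f.
Proof. exact: comp_assoc (markov_cat_laws C) _ _ _ _ _ _ _. Qed.

Lemma compid1 (x y : ob C) (f : hom x y) : f \;o idm x = f.
Proof. exact: comp_id_r (markov_cat_laws C) _ _ _. Qed.

Lemma comp1id (x y : ob C) (f : hom x y) : idm y \;o f = f.
Proof. exact: comp_id_l (markov_cat_laws C) _ _ _. Qed.

Lemma tensC (x y z x' y' z' : ob C)
    (g : hom y z) (f : hom x y) (g' : hom y' z') (f' : hom x' y') :
  (g \tx g') \;o (f \tx f') = (g \;o f) \tx (g' \;o f').
Proof. by rewrite (tens_comp (markov_cat_laws C)). Qed.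

Lemma tr_swap (x k y w : ob C) (g : hom x (k \ox w)) (h : hom (k \ox w) y) :
  exists t : traceable ((h \tx idm w)
      \;o (assoc_inv k w w \;o (idm k \tx swap w w) \;o assoc k w w)
      \;o (g \tx idm w)),
    tr T t = h \;o g.
Proof.
have [ty tyE] := yanking T w.
have [ts tsE] := superposition T (idm k) ty.
have [t tE] := tightening T g h ts.
exists t; rewrite tE tsE tyE (tens_id (markov_cat_laws C)).
by rewrite compid1.
Qed.

Variables (S : signature) (F : markov_functor (free_markov S) C).
Local Notation M := (free_markov S).

Lemma fhom_swap_factor (m n k w : ob M) (g : hom m (k \ox w)) (h : hom (k \ox w) n) :
  assoc_inv k w w \;o assoc k w w = idm (k \ox w \ox w) ->
  fhom_tens F ((h \tx idm w)
      \;o (assoc_inv k w w \;o ((idm k \tx swap w w) \;o (assoc k w w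
      \;o (g \tx idm w))))) =
  ((fhom F h \;o fmu F k w) \tx idm (F w))
      \;o (assoc_inv (F k) (F w) (F w) \;o (idm (F k) \tx swap (F w) (F w))
           \;o assoc (F k) (F w) (F w))
      \;o ((fmu_inv F k w \;o fhom F g) \tx idm (F w)).
Proof.
move=> assocK_M; rewrite /fhom_tens !fhom_comp.
have idE x : fhom F (idm x) = idm (F x) by apply: fhom_id.
have gE : fhom F (g \tx idm w) \;o fmu F m w = fmu F (k \ox w) w
    \;o (fmu F k w \tx idm (F w)) \;o ((fmu_inv F k w \;o fhom F g) \tx idm (F w)).
  rewrite fmu_nat -compA tensC compA fmu_invK comp1id compid1.
  by rewrite idE.
have aE := fmu_assoc F k w w.
have sE : fhom F (idm k \tx swap w w) \;o fmu F k (w \ox w)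
      \;o (idm (F k) \tx fmu F w w) =
    fmu F k (w \ox w) \;o (idm (F k) \tx fmu F w w)
      \;o (idm (F k) \tx swap (F w) (F w)).
  by rewrite fmu_nat -!compA !tensC fmu_swap idE !compid1.
have a'E : fhom F (assoc_inv k w w) \;o fmu F k (w \ox w)
      \;o (idm (F k) \tx fmu F w w) =
    fmu F (k \ox w) w \;o (fmu F k w \tx idm (F w)) \;o assoc_inv (F k) (F w) (F w).
  rewrite -[LHS]compid1 -(assoc_invK (markov_cat_laws C)).
  rewrite -[fhom F _ \;o _ \;o _]compA compA -[fhom F _ \;o _ \;o _]compA -aE.
  by rewrite !compA -fhom_comp assocK_M fhom_id comp1id.
have hE : fhom F (h \tx idm w) \;o fmu F (k \ox w) w = fmu F n w
    \;o (fhom F h \tx idm (F w)).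
  by rewrite fmu_nat idE.
have split_h : (fhom F h \;o fmu F k w) \tx idm (F w) =
    (fhom F h \tx idm (F w)) \;o (fmu F k w \tx idm (F w)).
  by rewrite tensC compid1.
have whisker (x y1 y2 y3 z1 z2 : ob C) (a : hom y3 z2) (b : hom y2 y3) (d : hom y1 y2)
    (a' : hom z1 z2) (b' : hom y1 z1) (r : hom x y1) :
  a \;o b \;o d = a' \;o b' -> a \;o (b \;o (d \;o r)) = a' \;o (b' \;o r).
  by move=> e; rewrite !compA e.
rewrite split_h -!compA gE -!compA (whisker _ _ _ _ _ _ _ _ _ _ _ _ aE) -!compA.
rewrite (whisker _ _ _ _ _ _ _ _ _ _ _ _ sE) -!compA.
rewrite (whisker _ _ _ _ _ _ _ _ _ _ _ _ a'E) -!compA.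
by rewrite [fhom F _ \;o (fmu F _ _ \;o _)]compA hE !compA fmuK comp1id.
Qed.

End MarkovCategories.
(** * Pushouts, normalization and isomorphisms of cospans *)

Section Cospans.
Variable S : signature.
Implicit Types m n k : seq (wire S).

Definition graph_hom (G H : graph S) (f : gwire G -> gwire H) (g : gbox G -> gbox H) :=
  [/\ forall x, wlab (f x) = wlab x, forall b, blab (g b) = blab b,
      forall b, gin (g b) = map f (gin b) & forall b, gout (g b) = map f (gout b)].

Lemma cospan_iso_hom m n (c d : cospan m n) f g :
  bijective f -> bijective g -> @graph_hom (apex c) (apex d) f g ->
  lleg d = map f (lleg c) -> rleg d = map f (rleg c) -> cospan_iso c d.
Proof. by move=> bf bg [? ? ? ?] ? ?; exists f, g. Qed.

Lemma size_lleg m n (c : cospan m n) : size (lleg c) = size m.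
Proof. by rewrite -(size_map wlab) lleg_lab. Qed.

Lemma size_rleg m n (c : cospan m n) : size (rleg c) = size n.
Proof. by rewrite -(size_map wlab) rleg_lab. Qed.

Lemma cospan_comp_iso m n k (c : cospan m n) (d : cospan n k) (e : cospan m k)
    (f1 : gwire (apex c) -> gwire (apex e)) (g1 : gbox (apex c) -> gbox (apex e))
    (f2 : gwire (apex d) -> gwire (apex e)) (g2 : gbox (apex d) -> gbox (apex e)) :
    premarkov d ->
    graph_hom f1 g1 -> graph_hom f2 g2 ->
    map f1 (rleg c) = map f2 (lleg d) ->
    lleg e = map f1 (lleg c) -> rleg e = map f2 (rleg d) ->
    injective f1 ->
    (forall b, b \notin lleg d -> forall a, f2 b <> f1 a) ->
    {in [predC lleg d] &, injective f2} ->
    (forall y, (exists a, y = f1 a) \/ (exists b, y = f2 b)) ->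
    bijective (fun x => match x with inl b => g1 b | inr b => g2 b end) ->
  cospan_iso (cospan_comp c d) e.
Proof.
move=> pre_d [fl1 gl1 gi1 go1] [fl2 gl2 gi2 go2] fE eL eR f1_inj f12 f2_inj f_surj g_bij.
pose f (x : gwire (gsum (apex c) (apex d))) :=
  match x with inl a => f1 a | inr b => f2 b end.
have f_rho x : f (comp_rho x) = f x.
  case: x => //= b; case aE: onth => [a|] //=.
  have /nth_index : b \in lleg d by rewrite -index_mem -(comp_size c) -onthTE aE.
  move/(_ b) => bE; have := congr1 (fun s => onth s (index b (lleg d))) fE.
  rewrite !onth_map aE /=; case b'E: onth => [b'|] //= [->].
  by rewrite -(onth_nth b _ _ _ b'E) bE.
have f_inj x y : f x = f y -> comp_rho (c := c) (d := d) x = comp_rho y.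
  rewrite -f_rho -[in RHS]f_rho.
  have rhoP z : (exists a, comp_rho (c := c) (d := d) z = inl a) \/
      (exists2 b, comp_rho (c := c) (d := d) z = inr b & b \notin lleg d).
    case: z => [a|b] /=; first by left; exists a.
    have [bd|nbd] := boolP (b \in lleg d); last first.
      right; exists b => //; by rewrite onth_default // (comp_size c d) leqNgt index_mem.
    case: onth (onthTE (rleg c) (index b (lleg d))) => [a|] /=; first by left; exists a.
    by rewrite (comp_size c d) index_mem bd.
  case: (rhoP x) (rhoP y) => [[a ->]|[b -> bd]] [[a' ->]|[b' -> b'd]] //=.
  - by move/f1_inj->.
  - by move/esym/(f12 _ b'd).
  - by move/(f12 _ bd).
  - by move/f2_inj->.
pose h (x : gwire (apex (cospan_comp c d))) := f (val x).
have hE x : h (cls _ x) = f x.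
  rewrite /h -f_rho -[in RHS]f_rho; congr f; apply/esym.
  apply/(cls_rho (comp_rho_glue pre_d) (@comp_glue_rho _ _ _ _ c d)).
  by apply/clsP/connect_root.
apply: (cospan_iso_hom (f := h)); last 4 first.
- exact: g_bij.
- split.
  + by move=> [[a|b] ?]; rewrite /h /=.
  + by case.
  + by case=> b; rewrite /= -!map_comp ?gi1 ?gi2; apply: eq_map => x; rewrite /= hE.
  + by case=> b; rewrite /= -!map_comp ?go1 ?go2; apply: eq_map => x; rewrite /= hE.
- by rewrite eL /= -map_comp; apply: eq_map => x; rewrite /= hE.
- by rewrite eR /= -map_comp; apply: eq_map => x; rewrite /= hE.
apply: inj_surj_bij => [x y | y].
  have [x' ->] := quot_ex x; have [y' ->] := quot_ex y.
  rewrite !hE => /f_inj xy.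
  exact/(cls_rho (comp_rho_glue pre_d) (@comp_glue_rho _ _ _ _ c d)).
case: (f_surj y) => [[a ->]|[b ->]].
  by exists (push_inl (comp_lab c d) a); rewrite hE.
by exists (push_inr (comp_lab c d) b); rewrite hE.
Qed.

Lemma map_push (G H : graph S) (u : seq (gwire G)) (v : seq (gwire H))
    (uv_lab : map wlab u = map wlab v) :
  map (push_inl uv_lab) u = map (push_inr uv_lab) v.
Proof.
have sz : size u = size v by rewrite -(size_map wlab) uv_lab size_map.
apply: eq_from_onth => i; rewrite !onth_map.
have [i_lt|i_ge] := ltnP i (size u); last by rewrite !onth_default // -sz.
have := i_lt; rewrite -onthTE; case aE: onth => [a|] // _.
have := i_lt; rewrite sz -onthTE; case bE: onth => [b|] // _ /=.
congr Some; apply/(clsP (push_pairs u v)); apply: connect1; apply/orP; left.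
by apply/push_pairsP; exists i, a, b.
Qed.

Lemma cospan_comp_congr m n k (c c' : cospan m n) (d d' : cospan n k) :
    premarkov d -> premarkov d' -> cospan_iso c c' -> cospan_iso d d' ->
  cospan_iso (cospan_comp c d) (cospan_comp c' d').
Proof.
move=> pre_d pre_d' [f1 [g1 [[bf1 bg1] [fl1 gl1] [gi1 go1] ll1 rl1]]].
move=> [f2 [g2 [[bf2 bg2] [fl2 gl2] [gi2 go2] ll2 rl2]]].
have pushE := map_push (comp_lab c' d').
apply: (cospan_comp_iso (e := cospan_comp c' d')
  (f1 := fun x => push_inl (comp_lab c' d') (f1 x)) (g1 := fun b => inl (g1 b))
  (f2 := fun x => push_inr (comp_lab c' d') (f2 x)) (g2 := fun b => inr (g2 b))).
- by [].
- split=> [x|b|b|b] /=.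
  + by rewrite -fl1; apply: (cls_lab (push_pairs_lab (comp_lab c' d'))).
  + exact: gl1.
  + by rewrite gi1 -!map_comp.
  + by rewrite go1 -!map_comp.
- split=> [x|b|b|b] /=.
  + by rewrite -fl2; apply: (cls_lab (push_pairs_lab (comp_lab c' d'))).
  + exact: gl2.
  + by rewrite gi2 -!map_comp.
  + by rewrite go2 -!map_comp.
- by rewrite (map_comp _ f1) (map_comp _ f2) -rl1 -ll2.
- by rewrite /= ll1 -map_comp.
- by rewrite /= rl2 -map_comp.
- exact: inj_comp (push_inl_inj pre_d') (bij_inj bf1).
- move=> b nb a /= /esym/(push_inlr pre_d')[j [_ jb]].
  case/negP: nb; rewrite -(mem_map (bij_inj bf2)) -ll2; apply/onthP.
  by exists j.
- move=> b b'; rewrite !inE => nb _ /= /(push_inr_inj pre_d').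
  rewrite ll2 (mem_map (bij_inj bf2)) => /(_ nb).
  exact: bij_inj.
- move=> y; have [[x|x] ->] := quot_ex y.
    left; have [f1' _ f1K] := bf1; exists (f1' x); rewrite /= f1K //.
  right; have [f2' _ f2K] := bf2; exists (f2' x); rewrite /= f2K //.
have [g1' g1K g1K'] := bg1; have [g2' g2K g2K'] := bg2.
exists (fun x => match x with inl b => inl (g1' b) | inr b => inr (g2' b) end).
  by case=> b /=; rewrite ?g1K ?g2K.
by case=> b /=; rewrite ?g1K' ?g2K'.
Qed.

Lemma cospan_tens_congr m n m' n' (c d : diagram m n) (c' d' : diagram m' n') :
  cospan_iso c d -> cospan_iso c' d' -> cospan_iso (diag_tens c c') (diag_tens d d').
Proof.
move=> [f1 [g1 [[[f1' f1K f1K'] [g1' g1K g1K']] [fl1 gl1] [gi1 go1] ll1 rl1]]].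
move=> [f2 [g2 [[[f2' f2K f2K'] [g2' g2K g2K']] [fl2 gl2] [gi2 go2] ll2 rl2]]].
exists (fun x => match x with inl b => inl (f1 b) | inr b => inr (f2 b) end).
exists (fun x => match x with inl b => inl (g1 b) | inr b => inr (g2 b) end).
split.
- split.
    exists (fun x => match x with inl b => inl (f1' b) | inr b => inr (f2' b) end);
    by case=> b /=; rewrite ?f1K ?f2K ?f1K' ?f2K'.
  exists (fun x => match x with inl b => inl (g1' b) | inr b => inr (g2' b) end);
  by case=> b /=; rewrite ?g1K ?g2K ?g1K' ?g2K'.
- by split; case=> b /=.
- by split; case=> b /=; rewrite ?gi1 ?gi2 ?go1 ?go2 -!map_comp.
- by rewrite /= ll1 ll2 !map_cat -!map_comp.
- by rewrite /= rl1 rl2 !map_cat -!map_comp.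
Qed.

Lemma deleted_min m n (c : cospan m n) (D : {set gbox (apex c)}) :
  (forall b, elim_after D b -> b \in D) -> deleted c \subset D.
Proof.
move=> D_closed.
have mono : {homo (fun D : {set gbox (apex c)} => [set b | elim_after D b]) :
    X Y / X \subset Y}.
  move=> X Y /subsetP XY; apply/subsetP => b'; rewrite !inE.
  apply: sub_all => w /andP[-> /forallP wX]; apply/forallP => b''.
  by apply/implyP => nY; apply: (implyP (wX b'')); apply: contra nY; apply: XY.
have step (i : nat) : iter i (fun D => [set b | elim_after D b]) set0 \subset D.
  elim: i => [|i IHi]; first exact: sub0set.
  by apply/subsetP => b /(subsetP (mono _ _ IHi)); rewrite inE => /D_closed.
exact: step.
Qed.

Lemma deleted_iso m n (c d : cospan m n) f g :
    bijective f -> bijective g -> @graph_hom (apex c) (apex d) f g ->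
    rleg d = map f (rleg c) ->
  forall b, b \in deleted c -> g b \in deleted d.
Proof.
move=> bf [g' gK g'K] [_ _ gi go] rl b.
suff /subsetP/(_ b) : deleted c \subset [set b | g b \in deleted d] by rewrite inE.
apply: deleted_min => {}b /allP elb; rewrite inE deletedE /elim_after go.
apply/allP => _ /mapP[x xb ->].
case/andP: (elb x xb) => nx /forallP xin.
rewrite rl (mem_map (bij_inj bf)) nx; apply/forallP => b'; apply/implyP => b'D.
have := xin (g' b'); rewrite inE g'K b'D /=.
by rewrite -(mem_map (bij_inj bf)) -gi g'K.
Qed.

Lemma cospan_iso_inv m n (c d : cospan m n) f g f' g' :
    cancel f f' -> cancel f' f -> cancel g' g -> @graph_hom (apex c) (apex d) f g ->
    lleg d = map f (lleg c) -> rleg d = map f (rleg c) ->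
  [/\ @graph_hom (apex d) (apex c) f' g', lleg c = map f' (lleg d) &
      rleg c = map f' (rleg d)].
Proof.
move=> fK f'K g'K [fl gl gi go] ll rl.
split; [ | by rewrite ll mapK | by rewrite rl mapK].
split=> x; first by rewrite -{2}[x]f'K fl.
- by rewrite -{2}[x]g'K gl.
- by rewrite -{2}[x]g'K gi mapK.
- by rewrite -{2}[x]g'K go mapK.
Qed.

Lemma kept_iso m n (c d : cospan m n) f g :
    bijective f -> bijective g -> @graph_hom (apex c) (apex d) f g ->
    lleg d = map f (lleg c) -> rleg d = map f (rleg c) ->
  forall x, kept (c := c) x -> kept (c := d) (f x).
Proof.
move=> bf bg fg ll rl x /forall_inP kx; apply/forall_inP => b bD.
have [[f' fK f'K] [g' gK g'K]] := (bf, bg).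
have [fg' ll' rl'] := cospan_iso_inv fK f'K g'K fg ll rl.
have bf' : bijective f' by exists f.
have bg' : bijective g' by exists g.
have := kx _ (deleted_iso bf' bg' fg' rl' bD).
by case: fg' => _ _ _ ->; rewrite -{1}[x]fK mem_map //; apply: bij_inj.
Qed.

Lemma norm_congr m n (c d : cospan m n) (pre_c : premarkov c) (pre_d : premarkov d) :
  cospan_iso c d -> cospan_iso (norm pre_c) (norm pre_d).
Proof.
move=> [f [g [[bf bg] [fl gl] [gi go] ll rl]]].
have [[f' fK f'K] [g' gK g'K]] := (bf, bg).
have fg : @graph_hom (apex c) (apex d) f g by split.
have [fg' ll' rl'] := cospan_iso_inv fK f'K g'K fg ll rl.
have bf' : bijective f' by exists f.
have bg' : bijective g' by exists g.
have kf := kept_iso bf bg fg ll rl; have kf' := kept_iso bf' bg' fg' ll' rl'.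
have dg b : (b \in ~: deleted c) -> g b \in ~: deleted d.
  by rewrite !inE; apply: contra => /(deleted_iso bf' bg' fg' rl'); rewrite gK.
have dg' b : (b \in ~: deleted d) -> g' b \in ~: deleted c.
  by rewrite !inE; apply: contra => /(deleted_iso bf bg fg rl); rewrite g'K.
pose F (x : gwire (apex (norm pre_c))) : gwire (apex (norm pre_d)) :=
  exist _ (f (val x)) (kf _ (valP x)).
pose F' (x : gwire (apex (norm pre_d))) : gwire (apex (norm pre_c)) :=
  exist _ (f' (val x)) (kf' _ (valP x)).
pose G (x : gbox (apex (norm pre_c))) : gbox (apex (norm pre_d)) :=
  exist _ (g (val x)) (dg _ (valP x)).
pose G' (x : gbox (apex (norm pre_d))) : gbox (apex (norm pre_c)) :=
  exist _ (g' (val x)) (dg' _ (valP x)).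
have restrF s : {in s, forall x, kept x} ->
    restrict (map f s) = map F (restrict (c := c) s).
  move=> ks; apply: (inj_map val_inj); rewrite restrictK.
    by rewrite -{1}(restrictK ks) -!map_comp.
  by move=> _ /mapP[x xs ->]; apply/kf/ks.
exists F, G; split.
- split; [exists F' | exists G']; move=> x; apply: val_inj => /=;
    by rewrite ?fK ?f'K ?gK ?g'K.
- by split=> x /=.
- split=> b /=; rewrite ?gi ?go restrF // => x.
    exact: kept_gin (norm_boxP b).
  exact: kept_gout (norm_boxP b).
- by rewrite /= ll restrF // => x; apply: kept_lleg.
- by rewrite /= rl restrF // => x; apply: kept_rleg.
Qed.

Lemma norm_diagram m n (d : diagram m n) (pre_d : premarkov d) :
  cospan_iso (norm pre_d) d.
Proof.
have D0 : deleted d = set0.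
  apply/eqP; rewrite -subset0; apply: deleted_min => b.
  by rewrite -[elim_after _ _]/(eliminable b) (negbTE (diag_normal b)).
have kd (x : gwire (apex d)) : kept x by apply/forall_inP => b; rewrite D0 inE.
have bd b : b \in ~: deleted d by rewrite D0 !inE.
apply: (@cospan_iso_hom m n (norm pre_d) d
  (fun x : gwire (norm_graph pre_d) => val x) (fun b : gbox (norm_graph pre_d) => val b)).
- by exists (fun x => exist _ x (kd x)) => x //; apply: val_inj.
- by exists (fun x => exist _ x (bd x)) => x //; apply: val_inj.
- by split=> // b; rewrite /= restrictK.
- by rewrite /= restrictK.
- by rewrite /= restrictK.
Qed.

Lemma sd_comp_class m n k (c : diagram m n) (d : diagram n k) (e : diagram m k) :
  cospan_iso (cospan_comp c d) e -> sd_comp (diag_class d) (diag_class c) = diag_class e.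
Proof.
move=> cde; apply/diag_classP; apply: cospan_iso_trans (norm_diagram (diag_pre e)).
apply: norm_congr; apply: cospan_iso_trans cde.
apply: cospan_comp_congr; try exact: diag_pre; exact: diag_repr_iso.
Qed.

Lemma sd_comp_norm m n k (c : diagram m n) (d : diagram n k) (e : cospan m k)
    (pre_e : premarkov e) :
  cospan_iso (cospan_comp c d) e ->
  sd_comp (diag_class d) (diag_class c) = diag_class (norm pre_e).
Proof.
move=> cde; apply/diag_classP/norm_congr; apply: cospan_iso_trans cde.
apply: cospan_comp_congr; try exact: diag_pre; exact: diag_repr_iso.
Qed.

Lemma sd_tens_class m n m' n' (c : diagram m n) (d : diagram m' n') :
  sd_tens (diag_class c) (diag_class d) = diag_class (diag_tens c d).
Proof. by apply/diag_classP/cospan_tens_congr; apply: diag_repr_iso. Qed.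

End Cospans.

(** * Composition with diagrams without boxes *)

Lemma map_onth_cat (A : Type) (s1 s2 s3 : seq A) :
  map (onth (s1 ++ s2 ++ s3)) (iota (size s1) (size s2)) = map Some s2.
Proof.
elim: s2 s1 => //= x s2 IHs s1.
have := IHs (rcons s1 x); rewrite size_rcons cat_rcons => ->; congr (_ :: _).
by rewrite onth_cat ltnn subnn.
Qed.

Lemma map_onth_iota (A : Type) (s : seq A) : map (onth s) (iota 0 (size s)) = map Some s.
Proof. by have := map_onth_cat [::] s [::]; rewrite cats0. Qed.

Lemma ex_map_ords (A : Type) (s : seq A) k :
  size s = k -> exists v : 'I_k -> A, map v (enum 'I_k) = s.
Proof. by move<-; exists (tnth (in_tuple s)); apply: map_tnth_enum (in_tuple s). Qed.

Section Wirings.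
Variable S : signature.
Implicit Types m n k : seq (wire S).

Definition wires_as m n (c : cospan m n) (q : seq nat) : Prop :=
  (gbox (apex c) -> False) /\ map Some (rleg c) = map (onth (lleg c)) q.

Lemma wires_as_iso m n (c d : cospan m n) q :
  cospan_iso c d -> wires_as c q -> wires_as d q.
Proof.
move=> [f [g [[bf [g' _ _]] _ _ ll rl]]] [nob cq]; split; first by move/g'/nob.
rewrite rl ll -map_comp.
rewrite (@eq_map _ _ _ (omap f \o Some)) // map_comp cq -map_comp.
by apply: eq_map => i; rewrite /= onth_map.
Qed.

Lemma wires_as_repr m n (c : diagram m n) q :
  wires_as c q -> wires_as (diag_repr (diag_class c)) q.
Proof. exact/wires_as_iso/cospan_iso_sym/diag_repr_iso. Qed.

Lemma wires_as_cast m n (mn : m = n) :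
  wires_as (diag_repr (sd_cast mn)) (iota 0 (size m)).
Proof.
apply: wires_as_repr; split; first by case.
by have := map_onth_iota (ords m); rewrite size_enum_ord => <-.
Qed.

Lemma wires_as_swap m n :
  wires_as (diag_repr (sd_swap m n)) (iota (size m) (size n) ++ iota 0 (size m)).
Proof.
apply: wires_as_repr; split; first by case.
rewrite /= -/(ords (m ++ n)); set s := ords _.
have sE : size s = size m + size n by rewrite size_enum_ord size_cat.
have st : size (take (size m) s) = size m by rewrite size_takel // sE leq_addr.
have sd : size (drop (size m) s) = size n by rewrite size_drop sE addKn.
rewrite !map_cat; congr (_ ++ _).
  have := map_onth_cat (take (size m) s) (drop (size m) s) [::].
  by rewrite cats0 cat_take_drop st sd => ->.
have := map_onth_cat [::] (take (size m) s) (drop (size m) s).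
by rewrite /= cat_take_drop st => ->.
Qed.

Lemma wires_as_tens m n m' n' (g : string_diagram m n) (h : string_diagram m' n') q q' :
    wires_as (diag_repr g) q -> wires_as (diag_repr h) q' ->
  wires_as (diag_repr (sd_tens g h)) (q ++ map (addn (size m)) q').
Proof.
move=> [gb gq] [hb hq]; apply: wires_as_repr; split; first by case.
rewrite /= !map_cat -!map_comp; congr (_ ++ _).
  rewrite (@eq_map _ _ _ (omap inl \o Some)) // map_comp gq -map_comp.
  apply/eq_in_map => i iq; rewrite /= onth_cat onth_map size_map.
  case: ifP => // /negbT; rewrite -onthTE.
  have : onth (lleg (diag_repr g)) i \in map Some (rleg (diag_repr g)).
    by rewrite gq map_f.
  by case/mapP=> x _ ->.
rewrite (@eq_map _ _ _ (omap inr \o Some)) // map_comp hq -map_comp.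
apply/eq_map => i; rewrite /= onth_cat onth_map size_map size_lleg.
by rewrite ltnNge leq_addr /= addKn onth_map.
Qed.

Section Rewire.
Variables (m n k : seq (wire S)) (c : diagram m n) (r : seq (gwire (apex c))).
Hypotheses (r_lab : map wlab r = k) (cr : {subset rleg c <= r}).

Definition rewire_cospan : cospan m k := Cospan (lleg_lab c) r_lab.

Lemma rewire_normal b : ~~ @eliminable _ m k rewire_cospan b.
Proof.
have := diag_normal b; apply: contra; apply: sub_all => x /andP[nx ->].
by rewrite andbT; apply: contra nx; apply: cr.
Qed.

Definition rewire : diagram m k :=
  @Diagram _ m k rewire_cospan (diag_pre c) rewire_normal.

Lemma sd_comp_wires (g : string_diagram n k) q :
    wires_as (diag_repr g) q -> map Some r = map (onth (rleg c)) q ->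
  sd_comp g (diag_class c) = diag_class rewire.
Proof.
rewrite -{2}[g]diag_reprK; move: (diag_repr g) => d [nob dq] rq.
apply: sd_comp_class.
have in_lleg x : x \in lleg d.
  have := (diag_pre d).2 x; rewrite big1 => [|b]; last by case: (nob b).
  by rewrite addn0 -has_pred1 has_count => ->.
have /choice[f fE] : forall x, exists y, onth (rleg c) (index x (lleg d)) = Some y.
  move=> x; have : onth (rleg c) (index x (lleg d)).
    by rewrite onthTE (comp_size c d) index_mem.
  by case: onth => // y; exists y.
have fL : map f (lleg d) = rleg c.
  apply: eq_from_onth => i; rewrite onth_map.
  have [i_lt|i_ge] := ltnP i (size (lleg d)); last first.
    by rewrite !onth_default // (comp_size c d).
  have := i_lt; rewrite -onthTE; case xE: onth => [x|] // _ /=.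
  by rewrite -fE (index_lleg (diag_pre d) xE).
have fR : map f (rleg d) = r.
  apply: (inj_map (@Some_inj _)); rewrite rq -fL -map_comp.
  rewrite (@eq_map _ _ _ (omap f \o Some)) // map_comp dq -map_comp.
  by apply: eq_map => i; rewrite /= onth_map.
apply: (@cospan_comp_iso _ m n k c d rewire id id f
  (fun b => match nob b return gbox (apex c) with end)).
- exact: diag_pre.
- by split=> // b; rewrite map_id.
- split; try by move=> b; case: (nob b).
  move=> x; have := fE x; have := comp_lab c d.
  move=> /(congr1 (fun s => onth s (index x (lleg d)))).
  rewrite !onth_map => + fx; rewrite fx /=.
  case x'E: onth => [x'|] //= [->]; congr wlab.
  by rewrite -(onth_nth x _ _ _ x'E) nth_index.
- by rewrite map_id fL.
- by rewrite map_id.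
- by rewrite fR.
- by [].
- by move=> b; rewrite in_lleg.
- by move=> b b'; rewrite !inE in_lleg.
- by left; exists y.
exists inl => [[b|b] //|//]; by case: (nob b).
Qed.

End Rewire.

Lemma sd_castK m n (mn : m = n) (nm : n = m) :
  sd_comp (sd_cast nm) (sd_cast mn) = sd_cast (erefl m).
Proof.
rewrite [sd_cast mn]/sd_cast /sd_wiring.
have r_lab : map wlab (ords m : seq (gwire (apex (wiring (ords_lab mn))))) = m.
  exact: (ords_lab (erefl m)).
have cr : {subset rleg (wiring (ords_lab mn)) <= ords m} by [].
rewrite (sd_comp_wires r_lab cr (wires_as_cast nm)); last first.
  by rewrite /= -mn; have := map_onth_iota (ords m); rewrite size_enum_ord => <-.
apply/diag_classP; apply: (@cospan_iso_hom _ m m (rewire r_lab cr)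
  (wiring (ords_lab (erefl m))) id id); rewrite ?map_id //.
- by exists id.
- by exists id.
Qed.

End Wirings.

(** * Early and late boxes *)

Definition sub_seq (A : eqType) (P : pred A) (s : seq A) : seq {x | P x} := pmap insub s.

Lemma sub_seqK (A : eqType) (P : pred A) (s : seq A) :
  {in s, forall x, P x} -> map val (sub_seq P s) = s.
Proof.
move=> sP; rewrite (pmap_filter (insubK _)).
by apply/all_filterP/allP => x /sP Px; rewrite insubT.
Qed.

Lemma mem_sub_seq (A : eqType) (P : pred A) (s : seq A) (x : {x | P x}) :
  (x \in sub_seq P s) = (val x \in s).
Proof. exact: mem_pmap_sub. Qed.

Lemma count_sub_seq (A : eqType) (P : pred A) (s : seq A) (x : {x | P x}) :
  {in s, forall y, P y} -> count_mem x (sub_seq P s) = count_mem (val x) s.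
Proof. by move=> sP; rewrite -[in RHS](sub_seqK sP) count_map. Qed.

Section Factorization.
Variable S : signature.
Variables (m n w : seq (wire S)) (c : diagram (m ++ w) (n ++ w)).
Hypothesis no_loop : forall x y,
  x \in leg_i' c -> y \in leg_j' c -> ~~ connect (@succ S (apex c)) x y.

Local Notation G := (apex c).

Definition reaches_out (x : gwire G) : bool :=
  [exists y in leg_j' c, connect (@succ S G) x y].
Definition early_box (b : gbox G) : bool := has reaches_out (gout b).
Definition early_wire (x : gwire G) : bool :=
  (x \in leg_i c) || [exists b, early_box b && (x \in gout b)].

Lemma mem_lleg x : (x \in lleg c) = (x \in leg_i c) || (x \in leg_i' c).
Proof. by rewrite -mem_cat cat_take_drop. Qed.

Lemma mem_rleg x : (x \in rleg c) = (x \in leg_j c) || (x \in leg_j' c).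
Proof. by rewrite -mem_cat cat_take_drop. Qed.

Lemma lleg_or_gout x : x \in lleg c \/ exists b, x \in gout b.
Proof.
have [xl|nxl] := boolP (x \in lleg c); [by left | right].
have := (diag_pre c).2 x; rewrite (count_memPn nxl) add0n => sum1.
apply/existsP; apply: contraT => /existsPn nx.
by move: sum1; rewrite big1 // => b _; apply/count_memPn.
Qed.

Lemma leg_i'_late x : x \in leg_i' c -> ~~ early_wire x.
Proof.
move=> xi'; rewrite negb_or; apply/andP; split.
  have := lleg_uniq (diag_pre c); rewrite -(cat_take_drop (size m) (lleg c)) cat_uniq.
  by case/and3P=> _ /hasPn/(_ x xi').
apply/existsPn => b; rewrite negb_and; apply/orP; right; apply/negP.
by apply: (lleg_gout (diag_pre c)); rewrite mem_lleg xi' orbT.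
Qed.

Lemma reaches_out_early x : reaches_out x -> early_wire x.
Proof.
move=> xr; apply/orP; case: (lleg_or_gout x) => [|[b xb]].
  rewrite mem_lleg => /orP[xi|xi']; first by left.
  by case/exists_inP: xr => y yj; rewrite (negbTE (no_loop xi' yj)).
right; apply/existsP; exists b; rewrite xb andbT.
by apply/hasP; exists x.
Qed.

Lemma gin_reaches_out b x : early_box b -> x \in gin b -> reaches_out x.
Proof.
case/hasP=> y yb /exists_inP[z zj yz] xb; apply/exists_inP; exists z => //.
by apply: connect_trans yz; apply/connect1/existsP; exists b; rewrite xb.
Qed.

Lemma leg_j'_reaches_out x : x \in leg_j' c -> reaches_out x.
Proof. by move=> xj; apply/exists_inP; exists x. Qed.

Lemma gout_early b : early_box b -> {in gout b, forall x, early_wire x}.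
Proof. by move=> eb x xb; apply/orP; right; apply/existsP; exists b; rewrite eb. Qed.

Lemma gin_early b : early_box b -> {in gin b, forall x, early_wire x}.
Proof. by move=> eb x /(gin_reaches_out eb)/reaches_out_early. Qed.

Lemma gout_late b x : ~~ early_box b -> x \in gout b -> ~~ early_wire x.
Proof.
move=> nb xb; rewrite negb_or; apply/andP; split.
  by apply/negP => xi; apply: (lleg_gout (diag_pre c) _ xb); rewrite mem_lleg xi.
apply/existsPn => b'; apply/negP => /andP[eb' xb'].
by move: nb; rewrite (gout_inj (diag_pre c) xb xb') eb'.
Qed.

(* All the early wires pass through the middle object, and not only those used
   by the late part: this makes both parts normal without further deletions. *)
Definition early_wires : seq (gwire G) := [seq x <- enum (gwire G) | early_wire x].
Definition middle : seq (wire S) := map wlab early_wires.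

Lemma mem_early_wires x : (x \in early_wires) = early_wire x.
Proof. by rewrite mem_filter mem_enum andbT. Qed.

Lemma leg_i_early : {in leg_i c, forall x, early_wire x}.
Proof. by move=> x xi; apply/orP; left. Qed.

Lemma early_rleg_early : {in early_wires ++ leg_j' c, forall x, early_wire x}.
Proof.
move=> x; rewrite mem_cat mem_early_wires => /orP[//|].
by move/leg_j'_reaches_out/reaches_out_early.
Qed.

Lemma sub_lab s : {in s, forall x, early_wire x} ->
  map (fun x : {x | early_wire x} => wlab (val x)) (sub_seq early_wire s) = map wlab s.
Proof. by move=> sP; rewrite -[in RHS](sub_seqK sP) -map_comp. Qed.

Definition early_graph : graph S :=
  @Graph S {x | early_wire x} {b | early_box b}
    (fun b => sub_seq early_wire (gin (val b)))
    (fun b => sub_seq early_wire (gout (val b)))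
    (fun x => wlab (val x)) (fun b => blab (val b))
    (fun b => etrans (sub_lab (gin_early (valP b))) (gin_lab (val b)))
    (fun b => etrans (sub_lab (gout_early (valP b))) (gout_lab (val b))).

Lemma early_rleg_lab : map wlab (early_wires ++ leg_j' c) = middle ++ w.
Proof. by rewrite map_cat leg_j'_lab. Qed.

Definition early_cospan : cospan m (middle ++ w) :=
  @Cospan S m (middle ++ w) early_graph
    (sub_seq early_wire (leg_i c)) (sub_seq early_wire (early_wires ++ leg_j' c))
    (etrans (sub_lab leg_i_early) (leg_i_lab c))
    (etrans (sub_lab early_rleg_early) early_rleg_lab).

Lemma early_premarkov : premarkov early_cospan.
Proof.
have [/acyclicP[r r_lt] mono] := diag_pre c; split.
  apply/acyclicP; exists (fun x => r (val x)) => x y /existsP[b].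
  rewrite !mem_sub_seq => xyb; apply: r_lt.
  by apply/existsP; exists (val b).
move=> x; rewrite -(mono (val x)) /= (count_sub_seq _ leg_i_early).
rewrite -(cat_take_drop (size m) (lleg c)) count_cat.
have -> : count_mem (val x) (drop (size m) (lleg c)) = 0.
  apply/count_memPn/negP => /leg_i'_late; by rewrite (valP x).
rewrite addn0; congr (_ + _).
under eq_bigr => b _ do rewrite (count_sub_seq _ (gout_early (valP b))).
rewrite -(big_sub early_box (fun b => count_mem (val x) (gout b))).
rewrite [RHS](bigID early_box) /= [X in _ = _ + X]big1 ?addn0 // => b nb.
by apply/count_memPn/negP => /(gout_late nb); rewrite (valP x).
Qed.

Lemma early_normal b : ~~ @eliminable _ _ _ early_cospan b.
Proof.
apply/negP => /allP elb; have /hasP[x xb xr] := valP b.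
have := elb (exist _ x (reaches_out_early xr)).
rewrite /= !mem_sub_seq => /(_ xb)/andP[+ _].
by rewrite mem_cat mem_early_wires reaches_out_early.
Qed.

Definition early : diagram m (middle ++ w) := Diagram early_premarkov early_normal.

Definition late_graph : graph S :=
  @Graph S (gwire G) {b | ~~ early_box b}
    (fun b => gin (val b)) (fun b => gout (val b)) wlab (fun b => blab (val b))
    (fun b => gin_lab (val b)) (fun b => gout_lab (val b)).

Lemma late_lleg_lab : map wlab (early_wires ++ leg_i' c) = middle ++ w.
Proof. by rewrite map_cat leg_i'_lab. Qed.

Definition late_cospan : cospan (middle ++ w) n :=
  @Cospan S (middle ++ w) n late_graph (early_wires ++ leg_i' c) (leg_j c)
    late_lleg_lab (leg_j_lab c).

Lemma late_premarkov : premarkov late_cospan.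
Proof.
have [/acyclicP[r r_lt] mono] := diag_pre c; split.
  apply/acyclicP; exists r => x y /existsP[b xyb]; apply: r_lt.
  by apply/existsP; exists (val b).
have sum1 (x : gwire G) : count_mem x (early_wires ++ leg_i' c) +
    \sum_(b | ~~ early_box b) count_mem x (gout b) = 1.
  rewrite -[RHS](mono x) count_cat.
  have [ex|nx] := boolP (early_wire x).
    rewrite mono big1 => [|b /gout_late nb]; last first.
      by apply/count_memPn/negP => /nb; rewrite ex.
    rewrite (count_uniq_mem x (filter_uniq _ (enum_uniq _))) mem_early_wires ex.
    by rewrite (count_memPn _) //; apply/negP => /leg_i'_late; rewrite ex.
  rewrite (count_memPn _) ?mem_early_wires //.
  rewrite -[X in _ = count_mem _ X + _](cat_take_drop (size m)).
  rewrite count_cat [X in _ = X + _ + _](count_memPn _); last first.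
    by apply: contra nx => /leg_i_early.
  congr (_ + _); rewrite [RHS](bigID early_box) /= [X in _ = X + _]big1 // => b eb.
  by apply/count_memPn; apply: contra nx => /(gout_early eb).
move=> x; rewrite -(sum1 x) /=; congr (_ + _).
exact: esym (big_sub (fun b => ~~ early_box b) (fun b => count_mem x (gout b))).
Qed.

Lemma late_normal b : ~~ @eliminable _ _ _ late_cospan b.
Proof.
apply/negP => /allP elb; have /negP := diag_normal (val b); apply.
have nr x : x \in gout (val b) -> ~~ reaches_out x.
  by move=> xb; apply: contra (valP b) => xr; apply/hasP; exists x.
apply/allP => x xb; have /andP[nx /forallP xin] := elb x xb.
rewrite mem_rleg negb_or nx (contra (@leg_j'_reaches_out x)) ?nr //=.
apply/forallP => b'; rewrite inE /=; have [eb'|nb'] := boolP (early_box b').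
  by apply: contra (nr x xb); apply: gin_reaches_out.
by have := xin (exist _ b' nb'); rewrite inE.
Qed.

Definition late : diagram (middle ++ w) n := Diagram late_premarkov late_normal.

Lemma early_late_bij :
  bijective (fun b : {b | early_box b} + {b | ~~ early_box b} =>
    match b with inl b => val b | inr b => val b end).
Proof.
apply: inj_surj_bij => [[b|b] [b'|b'] /=|b].
- by move/val_inj->.
- by move=> bb'; have := svalP b'; rewrite -bb' (svalP b).
- by move=> bb'; have := svalP b; rewrite bb' (svalP b').
- by move/val_inj->.
have [eb|nb] := boolP (early_box b); first by exists (inl (exist _ b eb)).
by exists (inr (exist _ b nb)).
Qed.

Lemma late_lleg x : x \notin lleg late -> ~~ early_wire x /\ x \notin leg_i' c.
Proof. by rewrite mem_cat negb_or mem_early_wires => /andP[]. Qed.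

Lemma early_late_contr : cospan_iso (cospan_comp early late) (contr_cospan c).
Proof.
set il := push_inl (contr_lab c).
have il_lab x : wlab (il x) = wlab x by apply: (cls_lab (push_pairs_lab (contr_lab c))).
have il_rho x y : il x = il y -> contr_rho (c := c) (inl x) = contr_rho (inl y).
  by move/(cls_rho (contr_rho_glue (diag_pre c) no_loop) (@contr_glue_rho _ _ _ _ c)).
have il_inj x y : x \notin leg_i' c -> y \notin leg_i' c -> il x = il y -> x = y.
  by move=> xi yi /il_rho; rewrite !contr_rho_id // => -[].
have il_ij : map il (leg_i' c) = map il (leg_j' c).
  have := map_push (contr_lab c); rewrite -/il.
  rewrite !map_cat => /eqP; rewrite eqseq_cat; last first.
    by rewrite [LHS]size_map [RHS]size_map size_leg_i' /wires size_enum_ord.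
  by case/andP=> /eqP-> /eqP->.
have early_val (x : gwire (apex early)) : val x \notin leg_i' c.
  by apply/negP => /leg_i'_late; rewrite (valP x).
have map_inl s : map (cls (push_pairs (leg_i' c ++ leg_j' c) (wires w ++ wires w)))
    (map inl s) = map il s by rewrite -map_comp.
have il_sub s : {in s, forall x, early_wire x} ->
    map (fun x : {x | early_wire x} => il (val x)) (sub_seq early_wire s) = map il s.
  by move=> sP; rewrite (map_comp il val) sub_seqK.
apply: (@cospan_comp_iso _ _ _ _ early late (contr_cospan c)
  (fun x => il (val x)) (fun b => inl (val b)) il (fun b => inl (val b))).
- exact: diag_pre.
- split=> [x|b|b|b] //=; first exact: il_lab.
    by rewrite (il_sub _ (gin_early (valP b))) -map_inl.
  by rewrite (il_sub _ (gout_early (valP b))) -map_inl.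
- by split=> [x|b|b|b] //=; rewrite ?map_inl //; exact: il_lab.
- by rewrite /= (il_sub _ early_rleg_early) !map_cat il_ij.
- by rewrite /= (il_sub _ leg_i_early).
- by [].
- by move=> x y /il_inj/val_inj; apply.
- move=> x /late_lleg[nx xi] y /il_inj xy; move: nx; rewrite xy ?(valP y) //.
- by move=> x y; rewrite !inE => /late_lleg[_ xi] /late_lleg[_ yi]; apply: il_inj.
- move=> y; right; have [[x|k] ->] := quot_ex y; first by exists x.
  have : push_inr (contr_lab c) k \in map il (leg_i' c ++ leg_j' c).
    by rewrite /il map_push map_f // mem_cat mem_enum.
  by case/mapP=> x _ xE; exists x.
have [h hK h'K] := early_late_bij.
exists (fun b : gbox G + void => match b with
  | inl b => h b
  | inr b => match b with end end).
  move=> [b|b]; first by rewrite (hK (inl b)).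
  by rewrite (hK (inr b)).
move=> [b|[]]; rewrite -[in RHS](h'K b).
by case: (h b).
Qed.

Let id_w : diagram w w := wiring (ords_lab (erefl w)).

Lemma sub_seq_cat (s t : seq (gwire G)) :
  sub_seq early_wire (s ++ t) = sub_seq early_wire s ++ sub_seq early_wire t.
Proof. exact: pmap_cat. Qed.

Let early_id := diag_tens early id_w.
Let out_k : seq (gwire (apex early_id)) := map inl (sub_seq early_wire early_wires).
Let out_w : seq (gwire (apex early_id)) := map inl (sub_seq early_wire (leg_j' c)).
Let in_w : seq (gwire (apex early_id)) := map inr (wires w).

Lemma rleg_early_id : rleg early_id = out_k ++ out_w ++ in_w.
Proof. by rewrite /= sub_seq_cat map_cat -catA. Qed.

Lemma swapped_lab : map wlab (out_k ++ in_w ++ out_w) = middle ++ (w ++ w).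
Proof.
have early_lab s : {in s, forall x, early_wire x} ->
    map (@wlab S (apex early_id)) (map inl (sub_seq early_wire s)) = map wlab s.
  by move=> /sub_lab <-; rewrite -map_comp.
rewrite !map_cat; congr (_ ++ (_ ++ _)).
- by rewrite early_lab // => x; rewrite mem_early_wires.
- by rewrite -[RHS](ords_lab (erefl w)) -map_comp.
- rewrite early_lab ?leg_j'_lab // => x.
  by move/leg_j'_reaches_out/reaches_out_early.
Qed.

Lemma early_late_factor :
  diag_class c = sd_comp (sd_tens (diag_class late) (sd_cast (erefl w)))
    (sd_comp (sd_cast (catA middle w w))
      (sd_comp (sd_tens (sd_cast (erefl middle)) (sd_swap w w))
        (sd_comp (sd_cast (esym (catA middle w w)))
          (sd_tens (diag_class early) (sd_cast (erefl w)))))).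
Proof.
have sz_k : size out_k = size middle.
  by rewrite !size_map -(size_map val) sub_seqK // => x; rewrite mem_early_wires.
have sz_in : size in_w = size w by rewrite size_map size_enum_ord.
have sz_out : size out_w = size w.
  rewrite size_map -(size_map val) sub_seqK ?size_leg_j' // => x.
  by move/leg_j'_reaches_out/reaches_out_early.
have map_iota (s : seq (gwire (apex early_id))) k : size s = k ->
    map Some s = map (onth s) (iota 0 k).
  by move<-; rewrite map_onth_iota.
rewrite [X in sd_tens _ X]/sd_cast /sd_wiring (sd_tens_class late) (sd_tens_class early).
have lab1 : map wlab (rleg early_id) = middle ++ (w ++ w).
  by rewrite catA rleg_lab.
have sub1 : {subset rleg early_id <= rleg early_id} by [].
rewrite (sd_comp_wires lab1 sub1 (wires_as_cast _)); last first.
  by apply: map_iota; rewrite size_rleg.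
have rE : rleg (rewire lab1 sub1) = out_k ++ out_w ++ in_w by exact: rleg_early_id.
have sub2 : {subset rleg (rewire lab1 sub1) <= out_k ++ in_w ++ out_w}.
  by move=> x; rewrite rE !mem_cat [X in _ || X]orbC.
rewrite (@sd_comp_wires _ _ _ _ (rewire lab1 sub1) _ swapped_lab sub2 _ _
  (wires_as_tens (wires_as_cast (erefl middle)) (wires_as_swap w w))); last first.
  rewrite rE [LHS]map_cat [RHS]map_cat; congr (_ ++ _).
    rewrite -sz_k.
    by have := map_onth_cat [::] out_k (out_w ++ in_w) => /= ->.
  rewrite map_cat -!iotaDl !map_cat addn0; congr (_ ++ _).
    have := map_onth_cat (out_k ++ out_w) in_w [::].
    by rewrite cats0 size_cat sz_k sz_out sz_in -[(out_k ++ _) ++ _]catA => ->.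
  by have := map_onth_cat out_k out_w in_w; rewrite sz_k sz_out => ->.
set e2 := @rewire _ _ _ _ (rewire lab1 sub1) _ swapped_lab sub2.
have lab3 : map wlab (rleg e2) = (middle ++ w) ++ w by rewrite rleg_lab catA.
have sub3 : {subset rleg e2 <= rleg e2} by [].
rewrite (@sd_comp_wires _ _ _ _ e2 _ lab3 sub3 _ _ (wires_as_cast _)); last first.
  exact: (map_iota _ _ (size_rleg e2)).
set e3 := @rewire _ _ _ _ e2 _ lab3 sub3.
apply/esym/sd_comp_class.
have [v vL] := ex_map_ords (size_leg_i' c).
have [v' v'L] := ex_map_ords (size_leg_j' c).
have v_lab u s (i : 'I_(size w)) : map u (enum 'I_(size w)) = s -> map wlab s = w ->
    @wlab S G (u i) = tnth (in_tuple w) i.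
  move=> <- us; have := etrans us (esym (map_tnth_enum (in_tuple w))).
  by rewrite -map_comp => /eq_in_map/(_ i (mem_enum _ i)).
have v_inj : injective v.
  apply/injectiveP; rewrite /injectiveb /dinjectiveb vL leg_i'_uniq //.
  exact: diag_pre.
have v_leg i : v i \in leg_i' c by rewrite -vL map_f // mem_enum.
pose f1 (x : gwire (apex early_id)) : gwire G :=
  match x with inl x => val x | inr i => v i end.
pose late_id := diag_tens late id_w.
pose f2 (x : gwire (apex late_id)) : gwire G :=
  match x with inl x => x | inr i => v' i end.
pose g1 (b : gbox (apex early_id)) : gbox G :=
  match b with inl b => val b | inr b => match b with end end.
pose g2 (b : gbox (apex late_id)) : gbox G :=
  match b with inl b => val b | inr b => match b with end end.
have f1_sub s : {in s, forall x, early_wire x} ->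
    map f1 (map inl (sub_seq early_wire s)) = s.
  by move=> sP; rewrite -map_comp; apply: sub_seqK.
have f1_in : map f1 (map inr (enum 'I_(size w))) = leg_i' c by rewrite -map_comp.
have f2_in : map f2 (map inr (enum 'I_(size w))) = leg_j' c by rewrite -map_comp.
have f2_inl s : map f2 (map inl s) = s by rewrite -map_comp; apply: map_id.
have late_id_lleg x : x \notin lleg late_id ->
    exists2 y, x = inl y & ~~ early_wire y /\ y \notin leg_i' c.
  case: x => [y|i]; rewrite mem_cat negb_or => /andP[y1 y2]; last first.
    by rewrite map_f ?mem_enum in y2.
  exists y => //; apply: late_lleg; apply: contra y1; exact: map_f.
apply: (@cospan_comp_iso _ _ _ _ e3 late_id c f1 g1 f2 g2).
- exact: diag_pre.
- split=> [[x|i]|[b|[]]|[b|[]]|[b|[]]] //=; first exact: v_lab vL (leg_i'_lab c).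
    by rewrite f1_sub //; apply: gin_early (valP b).
  by rewrite f1_sub //; apply: gout_early (valP b).
- split=> [[x|i]|[b|[]]|[b|[]]|[b|[]]] //=; first exact: v_lab v'L (leg_j'_lab c).
- rewrite /= !map_cat f1_in f2_in f2_inl.
  rewrite [map f1 out_k]f1_sub => [|x]; last by rewrite mem_early_wires.
  rewrite [map f1 out_w]f1_sub => [|x]; first by rewrite f2_inl catA.
  by move/leg_j'_reaches_out/reaches_out_early.
- rewrite /= map_cat f1_in f1_sub; last exact: leg_i_early.
  by rewrite cat_take_drop.
- by rewrite /= map_cat f2_in f2_inl cat_take_drop.
- move=> [x|i] [y|j] /=.
  + by move/val_inj->.
  + by move=> xy; have := leg_i'_late (v_leg j); rewrite -xy (valP x).
  + by move=> xy; have := leg_i'_late (v_leg i); rewrite xy (valP y).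
  + by move/v_inj->.
- move=> _ /late_id_lleg[x -> [nx xi]] [y|j] /= xy.
    by move: nx; rewrite xy (valP y).
  by move: xi; rewrite xy v_leg.
- move=> x y; rewrite !inE => /late_id_lleg[x' -> _] /late_id_lleg[y' -> _] /= -> //.
- by move=> y; right; exists (inl y).
have [h hK h'K] := early_late_bij.
exists (fun b => match h b with inl b => inl (inl b) | inr b => inr (inl b) end).
  by case=> [[b|[]]|[b|[]]] /=; [have /= -> := hK (inl b) | have /= -> := hK (inr b)].
by move=> b; rewrite -[in RHS](h'K b); case: (h b).
Qed.

End Factorization.

Theorem proposition31 (C : markov_category) (T : causal_traces C)
    (Sigma : signature) (F : markov_functor (free_markov Sigma) C)
    (m w n : ob (free_markov Sigma))
    (f : hom (tens_ob m w) (tens_ob n w)) (nsf : nonsignalling f) :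
  exists nsFf : nonsignalling (fhom_tens F f),
    fhom F (contr nsf) = tr T nsFf.
Proof.
pose c := diag_repr f; have no_loop := nonsignalling_no_loop nsf.
pose f1 : @hom (free_markov Sigma) m _ := diag_class (early no_loop).
pose f2 : @hom (free_markov Sigma) _ n := diag_class (late c).
have contrE : contr nsf = comp f2 f1.
  by apply/esym/sd_comp_norm/early_late_contr.
have fE := early_late_factor no_loop; rewrite diag_reprK in fE.
have [t tE] := tr_swap T (comp (fmu_inv F (middle c) w) (fhom F f1))
  (comp (fhom F f2) (fmu F (middle c) w)).
rewrite (etrans (congr1 (@fhom_tens _ _ F m w n w) fE)
  (fhom_swap_factor F f1 f2 (sd_castK _ _))).
exists t; rewrite tE contrE fhom_comp.
by rewrite compA -[_ \;o fmu_inv F _ _]compA fmu_invK compid1.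
Qed.
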